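(* For every finite simple connected planar graph $G$ with $n$ vertices and $m$ edges, $D(G) \le \frac{4(n-1)-m}{3}$.
   Context: $D(G)$ is the diameter of $G$: the maximum over all pairs of vertices of the distance (minimum number of edges on a path) between them. *)

(* Defs.v *)
From mathcomp Require Import all_boot all_order all_algebra.
From mathcomp Require Import classical_sets reals topology normedtype.
Import numFieldNormedType.Exports.

Set Implicit Arguments.
Unset Strict Implicit.
Unset Printing Implicit Defensive.

Import Order.TTheory GRing.Theory Num.Theory.
Local Open Scope ring_scope.

(* A finite simple graph on the vertex set T is a symmetric irreflexive
   relation e : rel T. *)

Definition edges (T : finType) (e : rel T) : {set {set T}} :=
  [set E : {set T} | [exists x, exists y, e x y && (E == [set x; y])]]%SET.

(* The null graph does not count as connected. *)
Definition connected_graph (T : finType) (e : rel T) : Prop :=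
  (0 < #|T|)%N /\ forall x y : T, connect e x y.

Definition has_path_of_length (T : finType) (e : rel T) (x y : T) (k : nat) :
    bool :=
  [exists p : k.-tuple T, [&& path e x p, uniq (x :: p) & last x p == y]].

(* A path has at most #|T| - 1 edges, so k < #|T| loses nothing; the default
   value #|T| is reached only when no path joins x to y. *)
Definition dist (T : finType) (e : rel T) (x y : T) : nat :=
  \big[minn/#|T|]_(k < #|T| | has_path_of_length e x y k) (k : nat).

Definition diameter (T : finType) (e : rel T) : nat :=
  (\max_(x : T) \max_(y : T) dist e x y)%N.

Definition arc_between (R : realType) (a b : R * R) (C : set (R * R)) : Prop :=
  exists g : R -> R * R,
    [/\ {within `[0, 1], continuous g}%classic,
        {in `[0, 1] &, injective g},
        g 0 = a, g 1 = b & C = (g @` `[0, 1])%classic].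

(* The drawing places the vertex x at pos x and draws the edge {x, y} as the
   arc (arc [set x; y]); the last two clauses say that an arc passes through no
   vertices but its own ends, and that two arcs meet at most in common ends. *)
Definition plane_drawing (R : realType) (T : finType) (e : rel T)
    (pos : T -> R * R) (arc : {set T} -> set (R * R)) : Prop :=
  [/\ injective pos,
      forall x y, e x y -> arc_between (pos x) (pos y) (arc [set x; y]%SET),
      forall E z, E \in edges e -> arc E (pos z) -> z \in E &
      forall E F, E \in edges e -> F \in edges e -> E != F ->
        (arc E `&` arc F `<=` pos @` [set z | z \in E :&: F])%classic].

Definition planar (R : realType) (T : finType) (e : rel T) : Prop :=
  exists (pos : T -> R * R) (arc : {set T} -> set (R * R)),
    plane_drawing e pos arc.

(* Main.v *)
Require Import Defs.
From mathcomp Require Import all_boot all_order all_algebra zify ring lra.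
From mathcomp Require Import boolp reals.
Set Implicit Arguments.
Unset Strict Implicit.
Unset Printing Implicit Defensive.
Import Order.TTheory GRing.Theory Num.Theory.
Local Open Scope ring_scope.

(** Let the layers be the sets of vertices at given distance from an end of a
    longest geodesic.  If all inner layers have at least three vertices, the
    inequality follows from m <= 3n - 6.  Otherwise one cuts the graph at a
    layer with one or two vertices and inducts; at a layer {u, v} without an
    edge the edge uv is added to the outer part, which stays planar because the
    connected inner part can be contracted to u.

    The bound m <= 3n - 6 is needed for planar graphs given by a topological
    drawing.  The drawing is first made discrete: a fine square grid carries the
    graph as a minor, each vertex owning a connected set of cells.  This form is
    stable under contractions.  On the grid a cycle mod 2 is the boundary of a
    set of grid corners, so the cycle space of the graph is spanned by the
    boundaries of its faces, and a dimension count over F_2 replaces the Jordan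
    curve theorem and Euler's formula. *)

(** A cut at a layer of s vertices, s = 1 or 2, counts these vertices and the edges inside the layer
    twice. The induction therefore proves a stronger bound for the part from such a layer outwards:
    m + 3k + 2(s + 1) <= 4n, where k further layers follow and m counts the added edge, if any. The
    constant makes the cut exact: 4s is the sum of s - 1 for the edge of the layer, s - 1 kept in
    reserve by the inner piece, and 2(s + 1). For s = 1 at the starting vertex it reads m + 3D + 4
    <= 4n, which is the claim. Two non-adjacent vertices would upset the count by one, and the added
    edge makes up for it. So planarity must survive contraction, which is awkward for arcs but only
    a change of colours for classes of grid cells.

    A face need not be a region of the plane: it is a class of grid corners joined along borders
    between colours. The dimension count asks only that face boundaries be cycles, span the cycle
    space and satisfy one linear relation. *)

Lemma addFF (x : 'F_2) : x + x = 0.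
Proof. by rewrite addrr_pchar2 // pchar_Fp. Qed.

Lemma F2_neq0 (x : 'F_2) : x != 0 -> x = 1.
Proof. by case: x => [[|[|k]] Hk] // _; apply/val_inj. Qed.

Lemma F2_addE (x y : 'F_2) : x + y = 0 -> x = y.
Proof. by move=> xy0; apply/eqP; rewrite -subr_eq0 oppr_pchar2 ?pchar_Fp // xy0. Qed.

(** Incidence mod 2, used for the two ends of an edge and for its two sides. For a = b it vanishes,
    so an edge with the same face on both sides is absent from the boundary of that face. *)
Definition inc2 (T : eqType) (a b x : T) : 'F_2 := (a == x)%:R + (b == x)%:R.

Lemma inc2_neq0 (T : eqType) (a b x : T) :
  inc2 a b x != 0 -> (a == x) || (b == x).
Proof. by rewrite /inc2; case: (a == x); case: (b == x); rewrite ?addr0 ?eqxx. Qed.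

Lemma sum_inc2 (T : finType) (X : {set T}) (F : T -> 'F_2) (a b : T) :
  a \in X -> b \in X -> \sum_(x in X) F x * inc2 a b x = F a + F b.
Proof.
move=> aX bX; rewrite /inc2.
under eq_bigr do rewrite mulrDr.
rewrite big_split /= (bigD1 a) //= (bigD1 (P := mem X) b) //= !eqxx !mulr1.
rewrite big1 ?big1 ?addr0 // => i /andP[_ Hi].
  by rewrite eq_sym (negPf Hi) mulr0.
by rewrite eq_sym (negPf Hi) mulr0.
Qed.

(** * The edge bound as a dimension count over F_2 *)

Lemma mxrank_const_cokernel (F : fieldType) (m n : nat) (A : 'M[F]_(m, n)) :
  A *m const_mx 1 = 0 :> 'M_(m, 1) -> (\rank A <= n.-1)%N.
Proof.
case: n A => [|n] A A1; first by rewrite (leq_trans (rank_leq_col _)).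
have /eqP c1 : \rank (const_mx 1 : 'M[F]_(n.+1, 1)) == 1%N.
  rewrite eqn_leq rank_leq_col lt0n mxrank_eq0; apply/eqP => /matrixP/(_ ord0 ord0).
  by rewrite !mxE => /eqP; rewrite oner_eq0.
by have := mulmx0_rank_max A1; rewrite c1 addn1.
Qed.

Section Euler.
Variables (T C : finType) (X : {set T}) (L : {set T * T}) (a b : T * T -> C).
Hypothesis LX : forall l, l \in L -> [/\ l.1 \in X, l.2 \in X & l.1 != l.2].
Hypothesis L_asym : forall l, l \in L -> (l.2, l.1) \notin L.

Let inc (l : T * T) x := inc2 l.1 l.2 x.
Let side l P := inc2 (a l) (b l) P.

Hypothesis cycle_cut : forall z : T * T -> 'F_2,
  (forall x, \sum_(l in L) z l * inc l x = 0) ->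
  exists S : C -> 'F_2, forall l, l \in L -> z l = S (a l) + S (b l).
Hypothesis side_even : forall P x, \sum_(l in L) side l P * inc l x = 0.

(** Elements of [C] that bound no edge, such as an isolated grid corner, are left out, as they would
    spoil the count of sides. *)
Let faces := [set P | [exists l in L, side l P != 0]].

(** The boundary of P has even degree at x, so no edge of it is alone there. *)
Let other_side P l x : l \in L -> side l P != 0 -> inc l x != 0 ->
  exists2 l', l' \in L :\ l & (side l' P != 0) && (inc l' x != 0).
Proof.
move=> lL lP lx; apply/exists_inP; apply: contraT => /exists_inPn N; exfalso.
have /eqP := side_even P x; rewrite (bigD1 l) //= (F2_neq0 lP) (F2_neq0 lx) big1.
  by rewrite mulr1 addr0 oner_eq0.
move=> i /andP[iL il]; have := N i; rewrite !inE il => /(_ iL).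
by rewrite negb_and !negbK => /orP[]/eqP-> ; rewrite ?mul0r ?mulr0.
Qed.

(** The boundary leaves each end of l by a further edge. The two further edges differ: a common one
    would have the same ends as l, hence be l or its reverse. *)
Let face_deg P : P \in faces -> (3 <= #|[set l in L | side l P != 0%R]|)%N.
Proof.
rewrite inE => /exists_inP[l lL lP].
have [x1 x2 xN] := LX lL.
have i1 : inc l l.1 != 0 by rewrite /inc /inc2 eqxx [_ == l.1]eq_sym (negPf xN) addr0 oner_eq0.
have i2 : inc l l.2 != 0 by rewrite /inc /inc2 eqxx (negPf xN) add0r oner_eq0.
have [l1 + /andP[p1 q1]] := other_side lL lP i1; rewrite !inE => /andP[n1 L1].
have [l2 + /andP[p2 q2]] := other_side lL lP i2; rewrite !inE => /andP[n2 L2].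
have n12 : l1 != l2.
  apply/eqP => E; subst l2; have [_ _ N1] := LX L1.
  have := inc2_neq0 q1; have := inc2_neq0 q2.
  have Na := L_asym lL; case: l l1 {p1 q1 p2 q2 i1 i2 lP L2 x1 x2} lL L1 n1 n2 N1 xN Na => x y [u v] /= lL L1 n1 n2 N1 xN Na.
  move=> /orP[]/eqP E1 /orP[]/eqP E2; subst => //.
  - by rewrite eqxx in xN.
  - by rewrite L1 in Na.
  - by rewrite eqxx in n1.
  - by rewrite eqxx in xN.
suff /subset_leq_card: [set l; l1; l2] \subset [set l in L | side l P != 0].
  apply: leq_trans; rewrite -setUA cardsU1 cardsU1 cards1 !inE.
  by rewrite negb_or (eq_sym l) (eq_sym l) n1 n2 n12.
by apply/subsetP => k; rewrite !inE => /orP[/orP[]|] /eqP->; rewrite ?lL ?L1 ?L2.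
Qed.

Let faces_le : (3 * #|faces| <= 2 * #|L|)%N.
Proof.
rewrite ![(_ * #|_|)%N]mulnC -!sum_nat_const.
apply: (@leq_trans (\sum_(P in faces) #|[set l in L | side l P != 0%R]|)%N).
  exact: leq_sum face_deg.
under eq_bigr do rewrite -sum1_card.
rewrite (exchange_big_dep (mem L)) /=; last by move=> P l _; rewrite inE => /andP[].
apply: leq_sum => l lL; rewrite sum1_card.
apply: leq_trans (_ : #|[set a l; b l]| <= 2)%N; last by rewrite cards2; case: (_ != _).
apply/subset_leq_card/subsetP => P; rewrite unfold_in !inE => /andP[_] /andP[_] /inc2_neq0.
by rewrite !(eq_sym P).
Qed.

Let A := \matrix_(l < #|L|, x < #|X|) inc (enum_val l) (enum_val x).
Let B := \matrix_(P < #|faces|, l < #|L|) side (enum_val l) (enum_val P).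

Let rank_A : (\rank A <= #|X|.-1)%N.
Proof.
apply: mxrank_const_cokernel; apply/matrixP => l j; rewrite !mxE.
under eq_bigr do rewrite !mxE mulr1.
rewrite -(big_enum_val (fun x => inc (enum_val l) x)) /=.
have [x1 x2 _] := LX (enum_valP l).
rewrite -[RHS](addFF 1) -(sum_inc2 (fun=> 1) x1 x2).
by apply: eq_bigr => x _; rewrite mul1r.
Qed.

Let faces_sum S l : l \in L -> \sum_(P in faces) S P * side l P = S (a l) + S (b l).
Proof.
move=> lL; rewrite -(sum_inc2 S (in_setT (a l)) (in_setT (b l))) big_mkcond /=.
rewrite [RHS]big_mkcond /=; apply: eq_bigr => P _; rewrite in_setT.
case: ifPn => //; rewrite inE => /exists_inPn/(_ l lL).
by rewrite negbK => /eqP E; rewrite -/(side l P) E mulr0.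
Qed.

Let rank_B : (\rank B <= #|faces|.-1)%N.
Proof.
rewrite -mxrank_tr; apply: mxrank_const_cokernel; apply/matrixP => l j; rewrite !mxE.
under eq_bigr do rewrite !mxE mulr1.
rewrite -(big_enum_val (fun P => side (enum_val l) P)) /=.
rewrite -[RHS](addFF 1) -(faces_sum (fun=> 1) (enum_valP l)).
by apply: eq_bigr => P _; rewrite mul1r.
Qed.

(** The function S that [cycle_cut] yields for a cycle gives, by its values on the faces, the
    coefficients of the cycle in the face boundaries. *)
Let ker_A : (kermx A <= B)%MS.
Proof.
apply/rV_subP => u /sub_kermxP uA0.
pose z l := \sum_(i < #|L|) u ord0 i * (enum_val i == l)%:R.
have zE i : z (enum_val i) = u ord0 i.
  rewrite /z (bigD1 i) //= eqxx mulr1 big1 ?addr0 // => j ji.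
  by rewrite (inj_eq enum_val_inj) (negPf ji) mulr0.
have sumL (F : T * T -> 'F_2) : \sum_(l in L) F l = \sum_(i < #|L|) F (enum_val i).
  exact: big_enum_val.
have [x|S zS] := cycle_cut (z := z).
  case: (boolP (x \in X)) => xX; last first.
    rewrite big1 // => l /LX[x1 x2 _].
    have -> : inc l x = 0; last by rewrite mulr0.
    apply/eqP/negPn/negP => /inc2_neq0/orP[]/eqP E; first by rewrite -E x1 in xX.
    by rewrite -E x2 in xX.
  have /matrixP/(_ ord0 (enum_rank_in xX x)) := uA0; rewrite !mxE sumL => E.
  by rewrite -[RHS]E; apply: eq_bigr => i _; rewrite zE !mxE enum_rankK_in.
apply/submxP; exists (\row_P S (enum_val P)); apply/rowP => i; rewrite !mxE.
rewrite -zE zS ?enum_valP // -faces_sum ?enum_valP //.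
under [RHS]eq_bigr do rewrite !mxE.
by rewrite -(big_enum_val (fun P => S P * side (enum_val i) P)).
Qed.

(* Each face has at least three sides and each edge at most two faces; the span of
   the face vectors contains the cycle space and has dimension less than the number of faces. *)
Lemma edges_le_of_cycle_cut : (3 <= #|X|)%N -> (#|L| + 6 <= 3 * #|X|)%N.
Proof.
move=> X3; have := leq_trans (mxrankS ker_A) rank_B; rewrite mxrank_ker.
(* Without faces the cycle space is zero and there are at most |X| - 1 edges; there |X| >= 3 is what
   gives the bound. *)
have := rank_A; have := faces_le.
move: #|faces| #|L| #|X| (\rank A) X3 => f l x r.
lia.
Qed.
End Euler.
(** * Grid minors *)

Definition cell := (nat * nat)%type.

(* The edge (d, p) of the grid joins p to its upper (d = true) or right
   (d = false) neighbour. A pair of numbers (i, j) also denotes the lower left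
   corner of the cell (i, j), so the dual of the edge e joins the corners
   [gtop e] and [gdiag e]. *)
Definition gedge := (bool * cell)%type.
Definition gtop (e : gedge) : cell :=
  if e.1 then (e.2.1, e.2.2.+1) else (e.2.1.+1, e.2.2).
Definition gdiag (e : gedge) : cell := (e.2.1.+1, e.2.2.+1).

(** * Chains mod 2 on the grid *)

Definition gstep : rel cell := fun p q => [exists d, (q == gtop (d, p)) || (p == gtop (d, q))].

Lemma gstep_sym : symmetric gstep.
Proof. by move=> p q; apply: eq_existsb => d; rewrite orbC. Qed.

(** [F] lives on corners: the two corners are the ends of the side that separates the two cells of
    [e]. *)
Definition coboundary (F : cell -> 'F_2) e : 'F_2 := F (gtop e) + F (gdiag e).

Definition boundary (Z : gedge -> 'F_2) (c : cell) : 'F_2 :=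
  Z (false, c) + Z (true, c)
  + (if c.1 is i.+1 then Z (false, (i, c.2)) else 0)
  + (if c.2 is j.+1 then Z (true, (c.1, j)) else 0).

(* The primitive at a corner counts the vertical edges on the horizontal ray to its left. *)
Lemma cycle_is_coboundary Z : (forall c, boundary Z c = 0) ->
  exists S, Z =1 coboundary S.
Proof.
move=> Z0; pose S (c : cell) := if c.2 is j.+1 then \sum_(i < c.1) Z (true, (nat_of_ord i, j)) else 0.
have ZS (d : bool) i j : Z (d, (i, j)) = coboundary S (d, (i, j)).
  rewrite /coboundary /S /gtop /gdiag /=; case: d => /=.
    by rewrite big_ord_recr /= addrA addFF add0r.
  (* Horizontal edges go column by column: the cycle condition at a cell expresses the edge to its
     right by the edge to its left and the two vertical ones. *)
  elim: i => [|i IH].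
    rewrite !big_ord_recr !big_ord0 /= add0r.
    have /= := Z0 (0, j)%N; rewrite /boundary /= addr0 -addrA.
    case: j => [|j] /= /F2_addE ->; first by rewrite addr0 add0r.
    by rewrite big_ord_recr big_ord0 /= add0r addrC.
  have /= := Z0 (i.+1, j); rewrite /boundary /= -!addrA => /F2_addE ->; rewrite {}IH.
  case: j => [|j]; first by rewrite addr0 !add0r [RHS]big_ord_recr /= addrC.
  set s := \sum_(i0 < i.+1) _; set t := \sum_(i0 < i.+1) _.
  rewrite [X in _ = X + _]big_ord_recr [X in _ = _ + X]big_ord_recr /= -/s -/t.
  by ring.
by exists S => -[d [i j]].
Qed.

Definition step_chain (p q : cell) (e : gedge) : 'F_2 :=
  (((e.2 == p) && (gtop e == q)) || ((e.2 == q) && (gtop e == p)))%:R.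

Lemma step_chainC p q : step_chain p q =1 step_chain q p.
Proof. by move=> e; rewrite /step_chain orbC. Qed.

Lemma step_chain_top e : step_chain e.2 (gtop e) =1 (fun e' => (e' == e)%:R).
Proof.
case: e => -[] [i j] [[] [i' j']];
  rewrite /step_chain /gtop /= !xpair_eqE /=; congr (_%:R); lia.
Qed.

Lemma boundary_eq Z Z' : Z =1 Z' -> boundary Z =1 boundary Z'.
Proof. by move=> E [[|i] [|j]]; rewrite /boundary /= !E. Qed.

Lemma boundary0 c : boundary (fun=> 0) c = 0.
Proof. by case: c => -[|i] [|j]; rewrite /boundary /= !addr0. Qed.

Lemma boundaryD (Z Z' : gedge -> 'F_2) c :
  boundary (fun e => Z e + Z' e) c = boundary Z c + boundary Z' c.
Proof.
rewrite /boundary [RHS]addrACA; congr (_ + _); last by case: c.2 => [|j]; rewrite ?addr0.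
rewrite [RHS]addrACA; congr (_ + _); last by case: c.1 => [|j]; rewrite ?addr0.
exact: addrACA.
Qed.

Lemma boundaryZ k (Z : gedge -> 'F_2) c : boundary (fun e => k * Z e) c = k * boundary Z c.
Proof. by rewrite /boundary !mulrDr; case: c => -[|i] [|j] /=; rewrite ?mulr0. Qed.

Lemma boundary_sum (I : finType) (L : {set I}) (Z : I -> gedge -> 'F_2) c :
  boundary (fun e => \sum_(l in L) Z l e) c = \sum_(l in L) boundary (Z l) c.
Proof. by rewrite /boundary !big_split; case: c => -[|i] [|j] /=; rewrite ?big1_eq. Qed.

Lemma boundary_step p q c : gstep p q -> boundary (step_chain p q) c = inc2 p q c.
Proof.
have bd1 e : boundary (fun e' => (e' == e)%:R) c = inc2 e.2 (gtop e) c.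
  case: e c => -[] [i j] [[|i'] [|j']];
  rewrite /boundary /inc2 /gtop /= !xpair_eqE /= ?addr0 -?natrD;
  apply: (congr1 (fun n => n%:R)); lia.
case/existsP => d /orP[/eqP->|/eqP->].
  by rewrite (boundary_eq (step_chain_top (d, p))) bd1.
rewrite (boundary_eq (step_chainC _ _)) (boundary_eq (step_chain_top (d, q))) bd1.
by rewrite /inc2 addrC.
Qed.

Fixpoint walk_chain (p : cell) (s : seq cell) (e : gedge) : 'F_2 :=
  if s is q :: s' then step_chain p q e + walk_chain q s' e else 0.

Lemma boundary_walk p s c : path gstep p s -> boundary (walk_chain p s) c = inc2 p (last p s) c.
Proof.
elim: s p => [|q s IH] p /=; first by rewrite boundary0 /inc2 addFF.
case/andP => pq qs; rewrite boundaryD boundary_step // IH // /inc2 addrA.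
by rewrite -(addrA (p == c)%:R) addFF addr0.
Qed.

Lemma walk_chain_in p s e : walk_chain p s e != 0 -> (e.2 \in p :: s) && (gtop e \in p :: s).
Proof.
elim: s p => [|q s IH] p //=.
case: (eqVneq (step_chain p q e) 0) => [-> | + _].
  by rewrite add0r => /IH/andP[h1 h2]; rewrite in_cons h1 in_cons h2 !orbT.
rewrite /step_chain; case: orP => [|_]; last by rewrite eqxx.
by case => /andP[/eqP-> /eqP->] _; rewrite !inE !eqxx ?orbT.
Qed.

(* A colouring phi of the cells whose classes are connected presents the graph
   [touch phi] as a minor of the grid. *)
Definition classes_connected (T : eqType) (phi : cell -> option T) :=
  forall x p q, phi p = Some x -> phi q = Some x ->
    exists s, [/\ path gstep p s, last p s = q & {in s, forall c, phi c = Some x}].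

(** The empty margin lets sums over the K by K square be shifted without boundary terms and bases
    every grid edge at a coloured cell inside that square. *)
Definition supported_in (T : eqType) (phi : cell -> option T) (K : nat) :=
  forall c, phi c -> (0 < c.1 < K)%N && (0 < c.2 < K)%N.

Definition touch (T : eqType) (phi : cell -> option T) (x y : T) :=
  exists p q, [/\ gstep p q, phi p = Some x & phi q = Some y].

Lemma sum_shift K (h : nat -> 'F_2) : h 0%N = 0 -> h K = 0 ->
  \sum_(i < K) h i.+1 = \sum_(i < K) h i.
Proof.
move=> h0 hK; have : \sum_(i < K.+1) h i = \sum_(i < K.+1) h i by [].
by rewrite {1}big_ord_recl big_ord_recr /= h0 hK addr0 add0r.
Qed.

(** Cycles are orthogonal to cuts: the coboundary of the corner function [F] is a cycle of cells,
    that of the cell function [Y] a cut. Summation by parts leaves at each cell its four sides,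
    around which every corner occurs twice. *)
Lemma pairing_coboundary (K : nat) (F Y : nat -> nat -> 'F_2) :
  (forall i j, Y i j != 0 -> (0 < i < K)%N && (0 < j < K)%N) ->
  \sum_(i < K) \sum_(j < K) ((F i.+1 j + F i.+1 j.+1) * (Y i j + Y i.+1 j)
    + (F i j.+1 + F i.+1 j.+1) * (Y i j + Y i j.+1)) = 0.
Proof.
move=> YK.
have Y0 i j : ~~ ((0 < i < K)%N && (0 < j < K)%N) -> Y i j = 0.
  by move=> H; apply/eqP; apply: contraNT H => /YK.
have E1 j : \sum_(i < K) (F i.+1 j + F i.+1 j.+1) * Y i.+1 j = \sum_(i < K) (F i j + F i j.+1) * Y i j.
  by rewrite -(sum_shift (h := fun i => (F i j + F i j.+1) * Y i j)) // Y0 ?mulr0 // ltnn andbF.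
have E2 (i : nat) : \sum_(j < K) (F i j.+1 + F i.+1 j.+1) * Y i j.+1 = \sum_(j < K) (F i j + F i.+1 j) * Y i j.
  by rewrite -(sum_shift (h := fun j => (F i j + F i.+1 j) * Y i j)) // Y0 ?mulr0 // ltnn !andbF.
have inner (i : 'I_K) :
  \sum_(j < K) ((F i.+1 j + F i.+1 j.+1) * (Y i j + Y i.+1 j)
    + (F i j.+1 + F i.+1 j.+1) * (Y i j + Y i j.+1)) =
  \sum_(j < K) (F i.+1 j + F i.+1 j.+1) * Y i.+1 j +
  \sum_(j < K) ((F i.+1 j + F i.+1 j.+1) + (F i j.+1 + F i.+1 j.+1) + (F i j + F i.+1 j)) * Y i j.
  under eq_bigr do rewrite [X in _ + X]mulrDr addrA.
  by rewrite big_split /= E2 -!big_split /=; apply: eq_bigr => j _; ring.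
rewrite (eq_bigr _ (fun i _ => inner i)) big_split /= exchange_big /=.
rewrite (eq_bigr _ (fun j _ => E1 (nat_of_ord j))) exchange_big -big_split big1 //= => i _.
rewrite -big_split big1 // => j _ /=.
move: (F i j) (F i.+1 j) (F i j.+1) (F i.+1 j.+1) (Y i j) => a b c d y.
rewrite -!mulrDl.
have -> : a + c + (b + d + (c + d) + (a + b)) = a + a + (b + b) + (c + c) + (d + d) by ring.
by rewrite !addFF mul0r.
Qed.

Lemma inc2C (T : eqType) (a b x : T) : inc2 a b x = inc2 b a x.
Proof. exact: addrC. Qed.

Lemma inc2_cat (T : eqType) (b a c x : T) : inc2 a b x + inc2 b c x = inc2 a c x.
Proof. by rewrite /inc2 addrA -(addrA (a == x)%:R) addFF addr0. Qed.

Lemma inc2_xx (T : eqType) (a x : T) : inc2 a a x = 0.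
Proof. exact: addFF. Qed.

Lemma gstep_top e : gstep e.2 (gtop e).
Proof. by apply/existsP; exists e.1; case: e => d p; rewrite eqxx. Qed.

(** An edge xy of the minor becomes a path of cells inside the class of x, across [e0], then inside
    the class of y. Between different colours it uses [e0] only, so a sum of such chains can be read
    off on representatives. *)
Lemma lifted_chain (T : eqType) (phi : cell -> option T) (e0 : gedge) x y u v :
  classes_connected phi -> phi e0.2 = Some x -> phi (gtop e0) = Some y ->
  phi u = Some x -> phi v = Some y ->
  exists Z, (forall c, boundary Z c = inc2 u v c) /\
    forall e, phi e.2 != phi (gtop e) -> Z e = (e == e0)%:R.
Proof.
move=> conn hx hy hu hv.
have [s1 [p1 l1 c1]] := conn _ _ _ hu hx.
have [s2 [p2 l2 c2]] := conn _ _ _ hy hv.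
exists (fun e => walk_chain u s1 e + step_chain e0.2 (gtop e0) e + walk_chain (gtop e0) s2 e).
split=> [c|e ne].
  by rewrite !boundaryD !boundary_walk // boundary_step ?gstep_top // l1 l2 !inc2_cat.
have mono p s z : phi p = Some z -> {in s, forall c, phi c = Some z} -> walk_chain p s e = 0.
  move=> pz sz; apply/eqP; apply: contraNT ne => /walk_chain_in.
  have all_z c : c \in p :: s -> phi c = Some z by rewrite inE => /predU1P[->|/sz].
  by case/andP => /all_z-> /all_z->.
by rewrite (mono _ _ x) // (mono _ _ y) // add0r addr0 step_chain_top.
Qed.

(** * Faces of a grid minor and its edge bound *)

Section GridEuler.
Variables (T : finType) (phi : cell -> option T) (K : nat) (X : {set T}) (L : {set T * T}).
Hypothesis phi_conn : classes_connected phi.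
Hypothesis phi_supp : supported_in phi K.
Hypothesis LX : forall l, l \in L -> [/\ l.1 \in X, l.2 \in X & l.1 != l.2].
Hypothesis L_asym : forall l, l \in L -> (l.2, l.1) \notin L.
Hypothesis L_touch : forall l, l \in L -> touch phi l.1 l.2.

Let joins (e : gedge) (l : T * T) :=
  (phi e.2 = Some l.1 /\ phi (gtop e) = Some l.2) \/ (phi e.2 = Some l.2 /\ phi (gtop e) = Some l.1).

Let reps : exists rep : T * T -> gedge, forall l, l \in L -> joins (rep l) l.
Proof.
suff /choice[rep repP] : forall l, exists e, l \in L -> joins e l by exists rep.
move=> l.
case: (boolP (l \in L)) => [lL|_]; last by exists (false, (0, 0)%N).
have [p [q [/existsP[d /orP[]/eqP->] hp hq]]] := L_touch lL.
  by exists (d, p) => _; left.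
by exists (d, q) => _; right.
Qed.

Let bases : exists r : T -> cell, forall x p, phi p = Some x -> phi (r x) = Some x.
Proof.
suff /choice[r rP] : forall x, exists r, forall p, phi p = Some x -> phi r = Some x by exists r.
move=> x.
have [[r hr]|N] := pselect (exists r, phi r = Some x); first by exists r.
by exists (0, 0)%N => p hp; case: N; exists p.
Qed.

Let joins_inc e l x : joins e l ->
  inc2 (phi e.2) (phi (gtop e)) (Some x) = inc2 l.1 l.2 x.
Proof. by case=> -[-> ->] //; rewrite inc2C. Qed.

Let joins_inj e l l' : l \in L -> l' \in L -> joins e l -> joins e l' -> l = l'.
Proof.
rewrite /joins; case: l l' => x y [x' y'] /= lL lL' [] [-> ->] [] [] [E1] [E2].
- by rewrite E1 E2.
- by have := L_asym lL; rewrite E1 E2 lL'.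
- by have := L_asym lL; rewrite E1 E2 lL'.
by rewrite E1 E2.
Qed.

(** A cycle of the graph lifts to a closed chain of cells; its primitive on corners is constant on
    faces because the chain avoids free edges. A face boundary is even at x because the coboundaries
    of the face and of the class of x are orthogonal. These are the two hypotheses of
    [edges_le_of_cycle_cut]. *)
Lemma grid_edges_le : (3 <= #|X|)%N -> (#|L| + 6 <= 3 * #|X|)%N.
Proof.
have [rep repP] := reps; have [r rP] := bases.
have rep_inj l l' : l \in L -> l' \in L -> rep l = rep l' -> l = l'.
  by move=> lL lL' E; apply: (joins_inj lL lL' (repP l lL)); rewrite E; apply: repP.
have rep_ne l : l \in L -> phi (rep l).2 != phi (gtop (rep l)).
  move=> lL; have [_ _] := LX lL; apply: contraNneq => E.
  by case: (repP l lL) => -[]; rewrite E => -> [->].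
have in_range e : phi e.2 != phi (gtop e) -> (e.2.1 < K)%N && (e.2.2 < K)%N.
  case: e => d [i j] /= ne.
  case E1: (phi (i, j)) ne (@phi_supp (i, j)) => [x|] ne s1; first by case/andP: (s1 isT) => /andP[_ /= ->] /andP[].
  case E2: (phi (gtop (d, (i, j)))) ne (@phi_supp (gtop (d, (i, j)))) => [x|] // _ /(_ isT).
  by rewrite /gtop; case: (d) => /=; lia.
(* Borders between colours that do not represent an edge of the graph; uncoloured cells count as one
   more colour. Corners joined along free borders form a face. *)
pose free e := (phi e.2 != phi (gtop e)) && [forall l in L, e != rep l].
pose C : finType := ('I_K.+1 * 'I_K.+1)%type.
pose cor (p : cell) : C := (inord p.1, inord p.2).
pose E : finType := (bool * ('I_K * 'I_K))%type.
pose ge (e : E) : gedge := (e.1, (nat_of_ord e.2.1, nat_of_ord e.2.2)).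
pose R : rel C := fun c c' => [exists e : E, free (ge e) &&
   (((c, c') == (cor (gtop (ge e)), cor (gdiag (ge e)))) ||
    ((c', c) == (cor (gtop (ge e)), cor (gdiag (ge e)))))].
have R_sym : connect_sym R.
  by apply: sym_connect_sym => c c'; apply: eq_existsb => e; rewrite orbC.
have ge_onto e : (e.2.1 < K)%N && (e.2.2 < K)%N -> exists e', e = ge e'.
  case: e => d [i j] /= /andP[iK jK].
  by exists (d, (Ordinal iK, Ordinal jK)).
pose face c := fingraph.root R c.
have face_free e : free e -> face (cor (gtop e)) = face (cor (gdiag e)).
  move=> fe; have [e' ee] : exists e', e = ge e' by apply/ge_onto/in_range; case/andP: fe.
  apply/eqP; rewrite root_connect //; apply/connect1/existsP; exists e'.
  by rewrite -ee fe eqxx.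
apply: (@edges_le_of_cycle_cut T C X L
  (fun l => face (cor (gtop (rep l)))) (fun l => face (cor (gdiag (rep l))))) => // [z zE|P x].
- have /choice[Z ZP] : forall l, exists Zl : gedge -> 'F_2, l \in L ->
    (forall c, boundary Zl c = inc2 (r l.1) (r l.2) c) /\
    forall e, phi e.2 != phi (gtop e) -> Zl e = (e == rep l)%:R.
    move=> l.
    case: (boolP (l \in L)) => [lL|_]; last by exists (fun=> 0).
    case: (repP l lL) => -[h1 h2].
      have [Z [Z1 Z2]] := lifted_chain phi_conn h1 h2 (rP _ _ h1) (rP _ _ h2).
      by exists Z.
    have [Z [Z1 Z2]] := lifted_chain phi_conn h1 h2 (rP _ _ h1) (rP _ _ h2).
    by exists Z => _; split=> // c; rewrite Z1 inc2C.
  pose W e := \sum_(l in L) z l * Z l e.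
  have W0 c : boundary W c = 0.
    rewrite boundary_sum; under eq_bigr => l lL do rewrite boundaryZ (ZP l lL).1.
    have incr l : inc2 (r l.1) (r l.2) c = \sum_x (r x == c)%:R * inc2 l.1 l.2 x.
      rewrite -(eq_bigl _ _ (fun x => in_setT x)).
      by rewrite (sum_inc2 (fun x => (r x == c)%:R)) ?in_setT.
    under eq_bigr do rewrite incr mulr_sumr.
    rewrite exchange_big big1 // => x _; under eq_bigr do rewrite mulrCA.
    by rewrite -mulr_sumr zE mulr0.
  have [S WS] := cycle_is_coboundary W0.
  pose S' (c : C) := S (nat_of_ord c.1, nat_of_ord c.2).
  have corK (c : cell) : (c.1 <= K)%N -> (c.2 <= K)%N -> S' (cor c) = S c.
    by case: c => i j /= iK jK; rewrite /S' !inordK.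
  have S'_edge e : (e.2.1 < K)%N && (e.2.2 < K)%N -> S' (cor (gtop e)) + S' (cor (gdiag e)) = W e.
    case: e => d [i j] /= /andP[iK jK]; rewrite WS /coboundary !corK //.
    - by rewrite /gtop; case: (d) => //=; apply: ltnW.
    - by rewrite /gtop; case: (d) => //=; apply: ltnW.
  have S'_face c : S' (face c) = S' c.
    have S'_free e : free e -> S' (cor (gtop e)) = S' (cor (gdiag e)).
      case/andP => ne /forall_inP fe; apply: F2_addE; rewrite S'_edge ?in_range //.
      by rewrite /W big1 // => l lL; rewrite (ZP l lL).2 // (negPf (fe l lL)) mulr0.
    have clR : closed R [pred c' | S' c' == S' c].
      apply: intro_closed => // c1 c2 /existsP[e /andP[fe H]]; rewrite !inE => /eqP <-.
      by case/orP: H => /eqP[-> ->]; rewrite (S'_free _ fe).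
    by apply/eqP; rewrite -[_ == _](closed_connect clR (connect_root R c)) inE.
  exists S' => l lL; rewrite !S'_face S'_edge ?in_range ?rep_ne //.
  rewrite /W (bigD1 l) //= (ZP l lL).2 ?rep_ne // eqxx mulr1 big1 ?addr0 // => l' /andP[lL' ll'].
  rewrite (ZP l' lL').2 ?rep_ne //.
  case: eqP => [/(rep_inj _ _ lL lL') E1|_]; last by rewrite mulr0.
  by rewrite E1 eqxx in ll'.
pose F i j : 'F_2 := (face (cor (i, j)) == P)%:R.
pose Y i j : 'F_2 := (phi (i, j) == Some x)%:R.
have YK i j : Y i j != 0 -> (0 < i < K)%N && (0 < j < K)%N.
  rewrite /Y; case: (phi (i, j) =P Some x) => [h _|_]; last by rewrite eqxx.
  by have := @phi_supp (i, j); rewrite h; apply.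
have := pairing_coboundary F YK.
pose G e := inc2 (face (cor (gtop e))) (face (cor (gdiag e))) P * inc2 (phi e.2) (phi (gtop e)) (Some x).
have -> : \sum_(i < K) \sum_(j < K) ((F i.+1 j + F i.+1 j.+1) * (Y i j + Y i.+1 j)
    + (F i j.+1 + F i.+1 j.+1) * (Y i j + Y i j.+1)) = \sum_(e : E) G (ge e).
  rewrite -(pair_bigA _ (fun d (p : 'I_K * 'I_K) => G (ge (d, p)))) /= big_bool /=.
  rewrite -!(pair_bigA _ (fun i j : 'I_K => G (ge (_, (i, j))))) /=.
  rewrite -big_split; apply: eq_bigr => i _; rewrite -big_split; apply: eq_bigr => j _.
  by rewrite /G /inc2 /F /Y /gtop /gdiag /= addrC.
move=> S0; rewrite -[RHS]S0; symmetry.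
have repE l : l \in L -> exists e, rep l = ge e by move=> lL; apply/ge_onto/in_range/rep_ne.
(* Inside one colour the incidence vanishes, and a free edge has the same face on both sides; only
   representatives contribute. *)
have Gzero e : ~~ [exists l in L, ge e == rep l] -> G (ge e) = 0.
  rewrite negb_exists_in => N; rewrite /G.
  case: (eqVneq (phi (ge e).2) (phi (gtop (ge e)))) => [->|ne]; first by rewrite inc2_xx mulr0.
  by rewrite face_free ?inc2_xx ?mul0r // /free ne.
rewrite (bigID (fun e => [exists l in L, ge e == rep l])) /= [X in _ + X]big1 // addr0.
have Grep l : l \in L -> G (rep l) = inc2 (face (cor (gtop (rep l)))) (face (cor (gdiag (rep l)))) P * inc2 l.1 l.2 x.
  by move=> lL; rewrite /G (joins_inc x (repP l lL)).
transitivity (\sum_(l in L) G (rep l)); last exact: eq_bigr Grep.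
have ge_inj : injective ge by move=> [d [i j]] [d' [i' j']] [-> /val_inj-> /val_inj->].
have Gsum l : l \in L -> G (rep l) = \sum_(e | ge e == rep l) G (ge e).
  move=> lL; have [e ee] := repE l lL; rewrite ee (big_pred1 e) // => e'; exact: inj_eq.
rewrite [RHS](eq_bigr _ Gsum) (exchange_big_dep (fun e => [exists l in L, ge e == rep l])) /=; last first.
  by move=> l e lL el; apply/exists_inP; exists l.
apply: eq_bigr => e /exists_inP[l lL /eqP el]; rewrite (big_pred1 l) // => l'.
apply/andP/eqP => [[lL' /eqP el']|->]; last by rewrite el.
by apply: rep_inj => //; rewrite -el.
Qed.
End GridEuler.

(** * Connected sets of cells; a grid minor from boxes and strips *)

Definition linked (P : cell -> Prop) (p q : cell) :=
  exists s, [/\ path gstep p s, last p s = q & {in p :: s, forall c, P c}].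

Lemma linked_refl (P : cell -> Prop) p : P p -> linked P p p.
Proof. by move=> Pp; exists [::]; split=> // c; rewrite inE => /eqP->. Qed.

Lemma linked_step (P : cell -> Prop) p q : P p -> P q -> gstep p q -> linked P p q.
Proof.
move=> Pp Pq pq; exists [:: q]; rewrite /= pq; split=> // c.
by rewrite !inE => /orP[]/eqP->.
Qed.

Lemma linked_trans P q p r : linked P p q -> linked P q r -> linked P p r.
Proof.
move=> [s [ps <- Ps]] [t [pt <- Pt]]; exists (s ++ t); rewrite cat_path ps pt last_cat.
split=> // c; rewrite -cat_cons mem_cat => /orP[/Ps //|ct].
by apply: Pt; rewrite inE ct orbT.
Qed.

Lemma linked_sym P p q : linked P p q -> linked P q p.
Proof.
move=> [s]; elim: s p q => [|r s IH] p q [/= ps <- Ps].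
  by apply: linked_refl; apply: Ps; rewrite mem_head.
case/andP: ps => pr rs; apply: (@linked_trans _ r).
  by apply: IH; split=> // c cs; apply: Ps; rewrite inE cs orbT.
by apply: linked_step; rewrite 1?gstep_sym //; apply: Ps; rewrite !inE eqxx ?orbT.
Qed.

Lemma sub_linked (P Q : cell -> Prop) p q :
  (forall c, P c -> Q c) -> linked P p q -> linked Q p q.
Proof. by move=> PQ [s [ps ls Ps]]; exists s; split=> // c /Ps/PQ. Qed.

Lemma linked_horizontal (P : cell -> Prop) i i' j :
  (forall k, (minn i i' <= k <= maxn i i')%N -> P (k, j)) -> linked P (i, j) (i', j).
Proof.
wlog ii : i i' / (i <= i')%N => [hw|].
  case/orP: (leq_total i i') => ii H; first exact: hw.
  by apply/linked_sym/hw => // k; rewrite minnC maxnC; apply: H.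
rewrite (minn_idPl ii) (maxn_idPr ii).
elim: i' ii => [|i' IH]; first by rewrite leqn0 => /eqP-> H; apply: linked_refl; apply: H.
rewrite leq_eqVlt => /predU1P[<- H|ii H]; first by apply: linked_refl; apply: H; lia.
apply: (@linked_trans _ (i', j)); first by apply: IH => // k /andP[h1 h2]; apply: H; lia.
apply: linked_step; [apply: H; lia | apply: H; lia |].
exact: (gstep_top (false, (i', j))).
Qed.

Lemma linked_vertical (P : cell -> Prop) i j j' :
  (forall k, (minn j j' <= k <= maxn j j')%N -> P (i, k)) -> linked P (i, j) (i, j').
Proof.
wlog jj : j j' / (j <= j')%N => [hw|].
  case/orP: (leq_total j j') => jj H; first exact: hw.
  by apply/linked_sym/hw => // k; rewrite minnC maxnC; apply: H.
rewrite (minn_idPl jj) (maxn_idPr jj).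
elim: j' jj => [|j' IH]; first by rewrite leqn0 => /eqP-> H; apply: linked_refl; apply: H.
rewrite leq_eqVlt => /predU1P[<- H|jj H]; first by apply: linked_refl; apply: H; lia.
apply: (@linked_trans _ (i, j')); first by apply: IH => // k /andP[h1 h2]; apply: H; lia.
apply: linked_step; [apply: H; lia | apply: H; lia |].
exact: (gstep_top (true, (i, j'))).
Qed.

Definition in_box (rho : nat) (c p : cell) : bool :=
  [&& c.1 <= p.1 + rho, p.1 <= c.1 + rho, c.2 <= p.2 + rho & p.2 <= c.2 + rho]%N.

Lemma in_box_linked rho c p q : in_box rho c p -> in_box rho c q -> linked (in_box rho c) p q.
Proof.
case: c p q => c c' [i j] [i' j']; rewrite /in_box /= => hp hq.
apply: (@linked_trans _ (i', j)); first by apply: linked_horizontal => k /=; lia.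
by apply: linked_vertical => k /=; lia.
Qed.

Definition grid_minor (T : finType) (e : rel T) (phi : cell -> option T) (K : nat) :=
  [/\ classes_connected phi, supported_in phi K & forall x y, e x y -> touch phi x y].

Lemma classes_connected_linked (T : finType) (phi : cell -> option T) :
  (forall x p q, phi p = Some x -> phi q = Some x -> linked (fun c => phi c = Some x) p q) ->
  classes_connected phi.
Proof.
move=> H x p q hp hq; have [s [ps ls Ps]] := H x p q hp hq.
by exists s; split=> // c cs; apply: Ps; rewrite inE cs orbT.
Qed.

Section Assemble.
Variables (T : finType) (O : {set T * T}) (box : T -> pred cell) (Q : T * T -> cell -> Prop) (K : nat).
Hypothesis O_irr : forall l, l \in O -> l.1 != l.2.
Hypothesis box_linked : forall x p q, box x p -> box x q -> linked (box x) p q.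
Hypothesis box_disjoint : forall x y p, box x p -> box y p -> x = y.
Hypothesis Q_box : forall l z p, l \in O -> Q l p -> box z p -> z = l.1 \/ z = l.2.
Hypothesis Q_disjoint : forall l l' p, l \in O -> l' \in O -> Q l p -> Q l' p -> l = l'.
Hypothesis Q_linked : forall l, l \in O -> exists p q, [/\ box l.1 p, box l.2 q & linked (Q l) p q].
Hypothesis box_supp : forall x p, box x p -> (0 < p.1 < K)%N && (0 < p.2 < K)%N.
Hypothesis Q_supp : forall l p, l \in O -> Q l p -> (0 < p.1 < K)%N && (0 < p.2 < K)%N.

(* The walk of the edge l, cut just before it enters the box of l.2. *)
Let tails : exists w : T * T -> seq cell, forall l, l \in O ->
  [/\ {in w l, forall c, Q l c /\ ~~ box l.2 c},
      forall c, c \in w l -> exists2 p, box l.1 p & linked (fun c => c \in w l) p c &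
      exists p q, [/\ p \in w l, box l.2 q & gstep p q]].
Proof.
suff /choice[w wP] : forall l, exists w : seq cell, l \in O -> 
  [/\ {in w, forall c, Q l c /\ ~~ box l.2 c},
      forall c, c \in w -> exists2 p, box l.1 p & linked (fun c => c \in w) p c &
      exists p q, [/\ p \in w, box l.2 q & gstep p q]] by exists w.
move=> l; case: (boolP (l \in O)) => [lO|_]; last by exists [::].
have [p [q [bp bq [s [ps ls Ps]]]]] := Q_linked lO.
have np : ~~ box l.2 p by apply: contraNN (O_irr lO) => /(box_disjoint bp)->.
have : has (box l.2) s.
  apply/hasP; exists q => //; have := mem_last p s; rewrite ls inE => /predU1P[qp|//].
  by rewrite -qp bq in np.
move=> hs; case/split_find: hs ps {ls} Ps => r s1 s2 br ns1.
rewrite cat_path rcons_path => /andP[/andP[ps1 pr] _] Ps.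
exists (p :: s1) => _; split=> [c cs|c cs|].
- split; first by apply: Ps; rewrite -cat_cons -rcons_cons mem_cat mem_rcons inE cs orbT.
  by move: cs; rewrite inE => /predU1P[->//|]; apply/hasPn.
- exists p => //; move: cs; rewrite inE => /predU1P[->|cs]; first by apply: linked_refl; rewrite mem_head.
  case/path.splitP: cs ps1 {Ps pr ns1} => a b; rewrite cat_path => /andP[pa _].
  exists (rcons a c); rewrite pa last_rcons; split=> // c' cc'.
  by rewrite -cat_cons mem_cat cc'.
by exists (last p s1), r; split=> //; apply: mem_last.
Qed.

(** The class of x is its box with the tails of all edges oriented away from x. A tail meets no box
    except that of its own start, so classes are disjoint; it ends next to the box of its head, so
    the two classes touch. *)
Lemma assemble (e : rel T) : symmetric e ->
  (forall x y, e x y -> ((x, y) \in O) || ((y, x) \in O)) ->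
  exists phi, grid_minor e phi K.
Proof.
move=> e_sym eO; have [w wP] := tails.
have box_w l z p : l \in O -> p \in w l -> box z p -> z = l.1.
  move=> lO pl bz; have [wb _ _] := wP l lO; have [Qp nb] := wb p pl.
  by case: (Q_box lO Qp bz) => // zE; rewrite zE (negPf nb) in bz *.
pose own x p := box x p || [exists l in O, (l.1 == x) && (p \in w l)].
have own_inj x y p : own x p -> own y p -> x = y.
  case/orP=> [bx|/exists_inP[l lO /andP[/eqP <- pl]]];
    case/orP=> [by_|/exists_inP[l' lO' /andP[/eqP <- pl']]].
  - exact: box_disjoint bx by_.
  - exact: box_w bx.
  - by apply/esym; apply: box_w by_.
  have [wb _ _] := wP l lO; have [wb' _ _] := wP l' lO'.
  by rewrite (Q_disjoint lO lO' (wb p pl).1 (wb' p pl').1).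
pose phi p := [pick x | own x p].
have phiE p x : (phi p = Some x) <-> own x p.
  rewrite /phi; case: pickP => [y yp|no]; split=> //; last by rewrite no.
    by case=> <-.
  by move=> xp; rewrite (own_inj _ _ _ yp xp).
have to_box x p : own x p -> exists2 q, box x q & linked (fun c => phi c = Some x) q p.
  move=> xp; case/orP: (xp) => [bx|/exists_inP[l lO /andP[/eqP lx pl]]].
    by exists p => //; apply/linked_refl/phiE.
  have [_ wl _] := wP l lO; have [q bq qp] := wl p pl.
  exists q; first by rewrite -lx.
  apply: sub_linked qp => c cw; apply/phiE/orP; right; apply/exists_inP; exists l => //.
  by rewrite lx eqxx.
exists phi; split.
- apply: classes_connected_linked => x p q /phiE/to_box[p' bp pp] /phiE/to_box[q' bq qq].
  apply: (linked_trans (linked_sym pp)); apply: linked_trans qq.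
  by apply: sub_linked (box_linked bp bq) => c bc; apply/phiE/orP; left.
- move=> p; case E: (phi p) => [x|] // _; move/phiE: E.
  case/orP => [/box_supp //|/exists_inP[l lO /andP[_ pl]]].
  by have [wb _ _] := wP l lO; apply: (Q_supp lO (wb p pl).1).
have O_touch l : l \in O -> touch phi l.1 l.2.
  move=> lO; have [_ _ [p [q [pw bq pq]]]] := wP l lO.
  exists p, q; split=> //; apply/phiE/orP; [right|by left].
  by apply/exists_inP; exists l; rewrite ?eqxx.
move=> x y /eO/orP[/O_touch //|/O_touch [p [q [pq hp hq]]]].
by exists q, p; split=> //; rewrite gstep_sym.
Qed.
End Assemble.

(** * Distance layers *)

(** Orienting each edge towards the end of larger rank counts it once. *)
Definition inner_edges (T : finType) (e : rel T) (X : {set T}) : {set T * T} :=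
  [set l | [&& e l.1 l.2, (enum_rank l.1 < enum_rank l.2)%N, l.1 \in X & l.2 \in X]].

Definition has_inner_edge (T : finType) (e : rel T) (X : {set T}) : bool :=
  [exists u in X, exists v in X, e u v].

Section InnerEdges.
Variables (T : finType) (e : rel T).
Hypotheses (e_sym : symmetric e) (e_irr : irreflexive e).

Lemma edge_oriented u v : e u v -> (enum_rank u < enum_rank v)%N || (enum_rank v < enum_rank u)%N.
Proof.
move=> uv; rewrite -neq_ltn (inj_eq (@ord_inj _)) (inj_eq enum_rank_inj).
by apply: contraTneq uv => ->; rewrite e_irr.
Qed.

Lemma inner_edgesP (X : {set T}) l : l \in inner_edges e X ->
  [/\ l.1 \in X, l.2 \in X & l.1 != l.2].
Proof.
rewrite inE => /and4P[el _ -> ->]; split=> //.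
by apply: contraTneq el => ->; rewrite e_irr.
Qed.

Lemma inner_edges_lt (X : {set T}) l : l \in inner_edges e X ->
  e l.1 l.2 /\ (enum_rank l.1 < enum_rank l.2)%N.
Proof. by rewrite inE => /and4P[]. Qed.

Lemma inner_edges_asym (X : {set T}) l : l \in inner_edges e X -> (l.2, l.1) \notin inner_edges e X.
Proof. by rewrite !inE /= => /and4P[_ lt _ _]; rewrite ltnNge (ltnW lt) andbF. Qed.

Lemma inner_edges_sub1 (X : {set T}) u v : e u v -> X \subset [set u; v] ->
  exists o, inner_edges e X \subset [set o].
Proof.
move=> uv Xuv; exists (if (enum_rank u < enum_rank v)%N then (u, v) else (v, u)).
apply/subsetP => l lX; have [l1 l2 l12] := inner_edgesP lX.
have [_ lt] := inner_edges_lt lX; move: (subsetP Xuv _ l1) (subsetP Xuv _ l2).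
case: l l12 lt {lX l1 l2} => x y /= xy lt; rewrite !inE => /orP[]/eqP xE /orP[]/eqP yE; subst x y.
- by rewrite eqxx in xy.
- by rewrite lt.
- by rewrite ltnNge (ltnW lt).
by rewrite eqxx in xy.
Qed.

Lemma card_inner_edges_le1 (X : {set T}) : (#|X| <= 1)%N -> #|inner_edges e X| = 0%N.
Proof.
move=> X1; apply/eqP; rewrite cards_eq0; apply/eqP/setP => l; rewrite in_set0.
apply/negP => /inner_edgesP[l1 l2 /eqP]; apply.
by apply: (card_le1_eqP X1).
Qed.

Lemma card_inner_edges2 (X : {set T}) : #|X| = 2%N -> #|inner_edges e X| = has_inner_edge e X.
Proof.
move=> X2; case: (boolP (has_inner_edge e X)) => [/exists_inP[x xX /exists_inP[y yX xy]]|no].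
  apply/eqP; rewrite eqn_leq; apply/andP; split.
    have xny : x != y by apply: contraTneq xy => ->; rewrite e_irr.
    have XE : [set x; y] = X.
      apply/eqP; rewrite eqEcard X2 cards2 xny andbT.
      by apply/subsetP => z; rewrite !inE => /orP[]/eqP->.
    have [|o /subset_leq_card] := @inner_edges_sub1 X x y xy; first by rewrite XE.
    by rewrite cards1.
  apply/card_gt0P; case/orP: (edge_oriented xy) => h; [exists (x, y)|exists (y, x)].
    by rewrite inE /= xy h xX.
  by rewrite inE /= e_sym xy h xX yX.
apply/eqP; rewrite cards_eq0; apply/eqP/setP => l; rewrite in_set0.
apply/negP => /[dup] /inner_edgesP[l1 l2 _] /inner_edges_lt[el _].
by case/negP: no; apply/exists_inP; exists l.1 => //; apply/exists_inP; exists l.2.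
Qed.

Lemma card_edges : #|edges e| = #|inner_edges e setT|.
Proof.
have -> : edges e = (fun l => [set l.1; l.2]) @: inner_edges e setT.
  apply/setP => E; apply/idP/imsetP => [|[l + ->]].
    rewrite inE => /existsP[x /existsP[y /andP[xy /eqP->]]].
    case/orP: (edge_oriented xy) => h; [exists (x, y)|exists (y, x)]; rewrite ?inE ?in_setT ?h ?xy //=.
      by rewrite e_sym xy.
    by rewrite setUC.
  move=> /inner_edges_lt[el _]; rewrite inE; apply/existsP; exists l.1; apply/existsP; exists l.2.
  by rewrite el eqxx.
apply: card_in_imset => -[x y] [x' y'] /[dup] /inner_edgesP/= [_ _ xy] lO lO' E.
have : x \in [set x'; y'] by rewrite -E !inE eqxx.
have : y \in [set x'; y'] by rewrite -E !inE eqxx orbT.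
rewrite !inE => /orP[]/eqP yE /orP[]/eqP xE; rewrite ?{}xE ?{}yE ?eqxx // in xy lO lO' *.
by have [_ /= h] := inner_edges_lt lO; have [_ /=] := inner_edges_lt lO'; rewrite ltnNge ltnW.
Qed.
End InnerEdges.

(** * The induction over distance layers *)

Section Layers.
Variables (T : finType) (e : rel T) (phi : cell -> option T) (K : nat).
Variables (x0 : T) (f : T -> nat) (D : nat).
Hypotheses (e_sym : symmetric e) (e_irr : irreflexive e).
Hypothesis model : grid_minor e phi K.
Hypothesis f0 : forall v, (f v == 0%N) = (v == x0).
Hypothesis f_edge : forall u v, e u v -> (f v <= (f u).+1)%N.
Hypothesis f_parent : forall v k, f v = k.+1 -> exists2 u, e u v & f u = k.
Hypothesis f_max : exists2 v, f v = D & forall u, (f u <= D)%N.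

Let layers a b := [set v | (a <= f v <= b)%N].
Let layer (a : nat) := [set v | f v == a].
Let E a b := #|inner_edges e (layers a b)|.
Let n a b := #|layers a b|.
Let sz (a : nat) := #|layer a|.
(* The layers below a can be contracted to one vertex of the layer a, which joins
   the two vertices of that layer if they are not adjacent. *)
Let extra (a : nat) : nat := (sz a == 2%N) && ~~ has_inner_edge e (layer a).

Let layer_gt0 a : (a <= D)%N -> (0 < sz a)%N.
Proof.
have [v vD _] := f_max => aD.
have {v vD} : exists v, f v = (a + (D - a))%N by exists v; rewrite subnKC.
elim: (D - a)%N => [|k IH] [v fv].
  by apply/card_gt0P; exists v; rewrite inE fv addn0.
by apply: IH; rewrite addnS in fv; have [u _ fu] := f_parent fv; exists u.
Qed.

Let layer0 : sz 0 = 1%N.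
Proof. by rewrite /sz -(cards1 x0); apply: eq_card => v; rewrite !inE f0. Qed.

Let layers1 a : layers a a = layer a.
Proof. by apply/setP => v; rewrite !inE eqn_leq andbC. Qed.

Let n1 a : n a a = sz a.
Proof. by rewrite /n layers1. Qed.

Let nS a b : (a <= b)%N -> n a b.+1 = (n a b + sz b.+1)%N.
Proof.
move=> ab; have -> : n a b.+1 = #|layers a b :|: layer b.+1|.
  by apply: eq_card => v; rewrite !inE; lia.
rewrite cardsU; suff -> : layers a b :&: layer b.+1 = set0 by rewrite cards0 subn0.
by apply/setP => v; rewrite !inE; lia.
Qed.

Let n_cut a b : (a <= b <= D)%N -> (n a D + sz b = n a b + n b D)%N.
Proof.
move=> /andP[ab]; elim: D => [|d IH] bd.
  by move: ab bd; rewrite leqn0 => + /eqP E0; subst b; rewrite leqn0 => /eqP ->; rewrite !n1.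
move: bd; rewrite leq_eqVlt => /predU1P[->|]; first by rewrite n1.
rewrite ltnS => bd; rewrite !nS //; last exact: leq_trans bd.
by rewrite addnAC IH // addnA.
Qed.

Let n_min a b : (forall i, (a < i < b)%N -> (3 <= sz i)%N) ->
  (a < b)%N -> (sz a + sz b + 3 * (b - a).-1 <= n a b)%N.
Proof.
elim: b => // b IH big; rewrite ltnS leq_eqVlt => /predU1P[<-|ab].
  by rewrite nS // n1 subSnn muln0 addn0.
rewrite nS ?(ltnW ab) // -addnA addnCA addnC leq_add2r.
have h3 : (3 <= sz b)%N by apply: big; rewrite ab ltnSn.
have h : (sz a + sz b + 3 * (b - a).-1 <= n a b)%N.
  by apply: IH => // i /andP[h1 h2]; apply: big; rewrite h1 ltnS ltnW.
move: h h3 ab; move: (sz a) (sz b) (n a b) => p q r; lia.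
Qed.

Let inner_layers a b l : l \in inner_edges e (layers a b) ->
  [/\ e l.1 l.2, (a <= f l.1 <= b)%N & (a <= f l.2 <= b)%N].
Proof. by rewrite !inE => /and4P[]. Qed.

(** Adjacent vertices differ by at most one in [f], so no edge jumps over the layer b. *)
Let E_cut a b : (a <= b <= D)%N -> (E a D + E b b = E a b + E b D)%N.
Proof.
move=> /andP[ab bD]; rewrite /E -[RHS]cardsUI; congr (_ + _)%N; apply: eq_card => l.
  rewrite !inE; case el: (e l.1 l.2) => //=; case: (_ < _)%N => //=.
  have := f_edge el; rewrite e_sym in el; have := f_edge el; lia.
by rewrite !inE; case: (e _ _) => //=; case: (_ < _)%N => //=; lia.
Qed.

(** With the added edge a layer of at most two vertices is complete. *)
Let E_extra a : (0 < sz a <= 2)%N -> (E a a + extra a = (sz a).-1)%N.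
Proof.
move=> /andP[s0 s2]; rewrite /E layers1 /extra; have [E2|ne] := eqVneq (sz a) 2%N.
  by rewrite card_inner_edges2 // E2; case: has_inner_edge.
have s1 : sz a = 1%N by move: s0 s2 ne; lia.
by rewrite card_inner_edges_le1 ?s1 //; apply: eq_leq.
Qed.

Let E_le a b : (3 <= n a b)%N -> (E a b + 6 <= 3 * n a b)%N.
Proof.
have [conn supp tou] := model.
apply: (grid_edges_le conn supp) => l lE; first exact: inner_edgesP lE.
  exact: inner_edges_asym lE.
by apply: tou; have [] := inner_layers lE.
Qed.

Section Contraction.
Variables (a b : nat) (u v : T).
Hypotheses (ab : (a <= b)%N) (fu : f u = a) (fv : f v = a) (uv : u != v) (nuv : ~~ e u v).

Let h w := if (f w < a)%N then u else w.
Let psi c := omap h (phi c).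

Let a_gt0 : (0 < a)%N.
Proof.
rewrite lt0n; apply: contra uv => /eqP a0.
have /eqP-> : u == x0 by rewrite -f0 fu a0.
by rewrite eq_sym -f0 fv a0.
Qed.

Let psiE c z : psi c = Some z -> exists2 w, phi c = Some w & h w = z.
Proof. by rewrite /psi; case: (phi c) => //= w [<-]; exists w. Qed.

(** A vertex merged into u reaches [x0] along parents. The parent of u itself already lies below the
    layer a, so the path stays in the merged class. *)
Let root_linked w c : h w = u -> phi c = Some w ->
  exists2 c0, phi c0 = Some x0 & linked (fun c => psi c = Some u) c0 c.
Proof.
have [conn _ tou] := model.
have same c1 c2 z : h z = u -> phi c1 = Some z -> phi c2 = Some z -> linked (fun c => psi c = Some u) c1 c2.
  move=> hz h1 h2; have [s [ps ls sP]] := conn _ _ _ h1 h2.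
  exists s; split=> // c'; rewrite inE => /predU1P[->|/sP]; rewrite /psi; first by rewrite h1 /= hz.
  by move=> -> /=; rewrite hz.
elim: (f w) {-2}w c (erefl (f w)) => [|k IH] {}w c fw hw cw.
  exists c; first by rewrite cw; congr Some; apply/eqP; rewrite -f0 fw.
  by apply: linked_refl; rewrite /psi cw /= hw.
have [w' ww' fw'] := f_parent fw.
have hw' : h w' = u.
  rewrite /h ifT // fw' -ltnS -fw ltnS; move: hw; rewrite /h; case: ltnP => [/ltnW //|_ ->].
  by rewrite fu.
have [p [q [pq hp hq]]] := tou _ _ ww'.
have [c0 c00 c0q] := IH w' p fw' hw' hp.
exists c0 => //; apply: (linked_trans c0q); apply: (linked_trans _ (same _ _ _ hw hq cw)).
by apply: linked_step; rewrite // /psi ?hq ?hp /= ?hw' ?hw.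
Qed.

Let psi_conn : classes_connected psi.
Proof.
have [conn _ _] := model.
apply: classes_connected_linked => z p q /psiE[w pw hw] /psiE[w' qw hw'].
have [zu|zu] := eqVneq z u.
  rewrite {}zu in hw hw' *; have [p0 p00 pl] := root_linked hw pw; have [q0 q00 ql] := root_linked hw' qw.
  apply: (linked_trans (linked_sym pl)); apply: linked_trans ql.
  have [s [ps ls sP]] := conn _ _ _ p00 q00.
  have /eqP fx0 : f x0 == 0%N by rewrite f0.
  have hx0 : h x0 = u by rewrite /h fx0 a_gt0.
  exists s; split=> // c; rewrite inE => /predU1P[->|/sP]; rewrite /psi ?p00 /= ?hx0 //.
  by move=> -> /=; rewrite hx0.
have h_id w1 : h w1 = z -> w1 = z by rewrite /h; case: ifP => // _ E1; rewrite E1 eqxx in zu.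
have [wz wz'] := (h_id _ hw, h_id _ hw'); rewrite wz in hw pw; rewrite wz' in qw.
have [s [ps ls sP]] := conn _ _ _ pw qw.
exists s; split=> // c; rewrite inE => /predU1P[->|/sP]; rewrite /psi ?pw /= ?hw //.
by move=> -> /=; rewrite hw.
Qed.

(** The parent of v lies in the layer a - 1 and is merged into u. Hence the classes of u and v
    touch, and uv counts as one more edge of the piece: 7 instead of 6. *)
Lemma contraction_le : (3 <= n a b)%N -> (E a b + 7 <= 3 * n a b)%N.
Proof.
have [_ supp tou] := model.
pose o := if (enum_rank u < enum_rank v)%N then (u, v) else (v, u).
have oE : (o == (u, v)) || (o == (v, u)) by rewrite /o; case: ifP; rewrite eqxx ?orbT.
have uL : u \in layers a b by rewrite inE fu leqnn.
have vL : v \in layers a b by rewrite inE fv leqnn.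
have oL : o.1 \in layers a b /\ o.2 \in layers a b by case/orP: oE => /eqP->.
have no : ~~ e o.1 o.2 by case/orP: oE => /eqP-> //=; rewrite e_sym.
have tpsi x y : (a <= f x)%N -> (a <= f y)%N -> e x y -> touch psi x y.
  move=> ax ay /tou [p [q [pq hp hq]]]; exists p, q; rewrite /psi hp hq /= /h.
  by rewrite !ltnNge ax ay.
have touch_sym x y : touch psi x y -> touch psi y x.
  by move=> [p [q [pq hp hq]]]; exists q, p; split; rewrite // gstep_sym.
have tuv : touch psi u v.
  have [k ak] : exists k, a = k.+1 by case: (a) a_gt0 => // k; exists k.
  have [w vw fw] := @f_parent v k (etrans fv ak).
  have [p [q [pq hp hq]]] := tou _ _ vw.
  exists p, q; rewrite pq /psi hp hq /= /h fw fv ak ltnn ltnSn; split=> //.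
move=> n3; have := @grid_edges_le T psi K (layers a b) (o |: inner_edges e (layers a b)) psi_conn.
rewrite cardsU1; have -> /= : o \notin inner_edges e (layers a b).
  by apply: contra no => /inner_edges_lt[].
rewrite -/(E a b) add1n => H; rewrite addnS; apply: H => //.
- by move=> c; rewrite /psi => pc; apply: supp; case: (phi c) pc.
- move=> l; rewrite in_setU1 => /predU1P[->|lE]; last exact: inner_edgesP lE.
  by case: oL => -> ->; split=> //; case/orP: oE => /eqP->; rewrite //= eq_sym.
- move=> l; rewrite !in_setU1 negb_or => /predU1P[->|lE].
    apply/andP; split; first by case/orP: oE => /eqP->; rewrite xpair_eqE negb_and ?uv // eq_sym uv.
    by apply: contra no => /inner_edges_lt[/=]; rewrite e_sym.
  rewrite (inner_edges_asym lE) andbT; apply: contra no => /eqP <- /=.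
  by rewrite e_sym; case: (inner_edges_lt lE).
move=> l; rewrite in_setU1 => /predU1P[->|lE].
  by case/orP: oE => /eqP-> //=; apply: touch_sym.
have [el /andP[l1 _] /andP[l2 _]] := inner_layers lE; exact: tpsi.
Qed.
End Contraction.

Let piece_le a b : (a <= b)%N -> (3 <= n a b)%N -> (E a b + extra a + 6 <= 3 * n a b)%N.
Proof.
move=> ab n3; rewrite /extra; case: andP => [[/cards2P[u [v [uv lE]]] no]|_]; last first.
  by rewrite addn0; apply: E_le.
have ul : u \in layer a by rewrite lE !inE eqxx.
have vl : v \in layer a by rewrite lE !inE eqxx orbT.
rewrite -addnA; apply: (@contraction_le a b u v) => //; try by apply/eqP; rewrite -[_ == _]in_set // inE.
- by move: ul; rewrite inE => /eqP.
- by move: vl; rewrite inE => /eqP.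
apply: contra no => euv; apply/exists_inP; exists u => //.
by apply/exists_inP; exists v.
Qed.
(** [piece_le] gives 3n - 6, and [n_min] turns the fourth n into the remaining terms, where [sz a]
    <= 2 is just enough. Two consecutive layers of one vertex each have n = 2, outside the planar
    bound, and are checked directly. *)
Let first_piece_le a i : (a < i)%N -> (0 < sz a <= 2)%N -> (0 < sz i <= 2)%N ->
  (forall j, (a < j < i)%N -> (3 <= sz j)%N) ->
  (E a i + extra a + 3 * (i - a) + 2 * (sz a).+1 + (sz i).-1 <= 4 * n a i)%N.
Proof.
move=> ai sa si big; have nmin := n_min big ai.
have [n3|] := leqP 3 (n a i).
  have := piece_le (ltnW ai) n3; move: ai sa si nmin n3.
  by move: (E a i) (extra a) (sz a) (sz i) (n a i) => p q r t m; clear; lia.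
move=> n2; have [a1 i1 ia n_2] : [/\ sz a = 1%N, sz i = 1%N, i = a.+1 & n a i = 2%N].
  move: ai sa si nmin n2; move: (sz a) (sz i) (n a i) => r t m; clear => *; split; lia.
have -> : extra a = 0%N by rewrite /extra a1.
have : (E a i <= 1)%N by rewrite /E card_inner_edges2 //; case: has_inner_edge.
by rewrite a1 i1 n_2 ia; move: (E _ _) => p; clear; lia.
Qed.

(** The next small layer i ends a piece whose inner layers are large. Adding the bound for this
    piece to the one from i onwards, with [E_extra] at i, cancels every term in [sz i]. *)
Let layers_le a : (a <= D)%N -> (sz a <= 2)%N ->
  (E a D + extra a + 3 * (D - a) + 2 * (sz a).+1 <= 4 * n a D)%N.
Proof.
have [k Dk] := ubnP (D - a)%N; elim: k a Dk => // k IH a; rewrite ltnS => Dk aD s2.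
have s0 := layer_gt0 aD.
pose P i := (a < i <= D)%N && (sz i <= 2)%N.
have [exP|nP] := pselect (exists i, P i).
  case: (ex_minnP exP) => i /andP[/andP[ai iD] i2] imin.
  have i0 := layer_gt0 iD.
  have big j : (a < j < i)%N -> (3 <= sz j)%N.
    move=> /andP[aj ji]; rewrite ltnNge; apply/negP => j2.
    have ij : (i <= j)%N by apply: imin; rewrite /P aj j2 (leq_trans (ltnW ji) iD).
    by rewrite leqNgt ji in ij.
  have aiD : (a <= i <= D)%N by rewrite ltnW.
  have sa : (0 < sz a <= 2)%N by rewrite s0.
  have si : (0 < sz i <= 2)%N by rewrite i0.
  have Dik : (D - i < k)%N by move: ai iD Dk; clear; lia.
  have := first_piece_le ai sa si big; have := IH i Dik iD i2.
  have := E_extra si; have := E_cut aiD; have := n_cut aiD.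
  move: ai iD i0 i2; move: (E a D) (E a i) (E i D) (E i i) (n a D) (n a i) (n i D) (extra a) (extra i) (sz a) (sz i).
  clear; lia.
have big i : (a < i <= D)%N -> (3 <= sz i)%N.
  by move=> aiD; rewrite ltnNge; apply/negP => i2; apply: nP; exists i; rewrite /P aiD.
(* For a = D and s = [sz a] the left side is (s - 1) + 2(s + 1) = 3s + 1 <= 4s. For a < D the last
   layer is large too, so n >= s + 3(D - a). *)
move: (aD); rewrite leq_eqVlt => /predU1P[aE|ltaD].
  have sa : (0 < sz a <= 2)%N by rewrite s0.
  have := E_extra sa; rewrite -aE n1; move: s0 s2.
  by move: (E a a) (extra a) (sz a) => p q r; clear; lia.
have big' i : (a < i < D)%N -> (3 <= sz i)%N by move=> /andP[h1 h2]; rewrite big // h1 ltnW.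
have := n_min big' ltaD; have sD : (3 <= sz D)%N by rewrite big // ltaD leqnn.
have := @piece_le a D aD.
move: ltaD s0 s2 sD; move: (E a D) (extra a) (sz a) (sz D) (n a D) => p q r t m.
clear; lia.
Qed.

Lemma card_edges_layers_le : (#|edges e| + 3 * D + 4 <= 4 * #|T|)%N.
Proof.
have -> : #|edges e| = E 0 D.
  rewrite card_edges // /E; congr #|inner_edges e _|; apply/setP => v.
  by have [_ _ fD] := f_max; rewrite !inE fD.
have -> : #|T| = n 0 D.
  by rewrite -cardsT; apply: eq_card => v; have [_ _ fD] := f_max; rewrite !inE fD.
have := layers_le (leq0n D); rewrite layer0 subn0 => /(_ isT).
by move: (E 0 D) (extra 0) (n 0 D); clear; lia.
Qed.
End Layers.

(** * Distances as a layer function *)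

Section DistanceLayers.
Variables (T : finType) (e : rel T).

Lemma bigminn_le (I : eqType) (r : seq I) (P : pred I) (F : I -> nat) x i :
  i \in r -> P i -> (\big[minn/x]_(j <- r | P j) F j <= F i)%N.
Proof.
move=> + Pi; elim: r => // j r IH; rewrite inE big_cons => /predU1P[<-|/IH ir].
  by rewrite Pi geq_minl.
by case: ifP => // _; rewrite geq_min ir orbT.
Qed.

Lemma dist_le_walk x y p : path e x p -> last x p = y -> (dist e x y <= size p)%N.
Proof.
move=> xp xy; have := xy; case/shortenP: xp => p' xp' up' p'p ly.
have sp' : (size p' < #|T|)%N.
  by rewrite -[X in (X <= _)%N]/(size (x :: p')) -(card_uniqP up') max_card.
apply: leq_trans (_ : size p' <= _)%N; last first.
  by apply: uniq_leq_size => //; case/andP: up'.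
rewrite /dist; apply: (@bigminn_le _ _ _ (fun k : 'I_#|T| => k : nat) _ (Ordinal sp')).
  by rewrite mem_index_enum.
by apply/existsP; exists (in_tuple p'); apply/and3P; split=> //; apply/eqP.
Qed.

Definition walk_length x y k := [exists p : k.-tuple T, path e x p && (last x p == y)].

Lemma walk_lengthP x y k :
  reflect (exists p, [/\ path e x p, last x p = y & size p = k]) (walk_length x y k).
Proof.
apply: (iffP existsP) => [[p /andP[xp /eqP py]]|[p [xp py sp]]].
  by exists p; rewrite size_tuple.
by exists (tcast sp (in_tuple p)); rewrite val_tcast /= xp py eqxx.
Qed.

(** [f] is the least length of a walk: walks, unlike simple paths, can always be prolonged by an
    edge, and shortening a walk bounds [dist]. *)
Lemma distance_layers x0 : (forall y, connect e x0 y) ->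
  exists f : T -> nat, [/\ forall v, (f v == 0%N) = (v == x0),
    forall u v, e u v -> (f v <= (f u).+1)%N,
    forall v k, f v = k.+1 -> exists2 u, e u v & f u = k &
    forall v, (dist e x0 v <= f v)%N].
Proof.
move=> conn.
have ex v : exists k, walk_length x0 v k.
  by have /connectP[p xp ->] := conn v; exists (size p); apply/walk_lengthP; exists p.
pose f v := ex_minn (ex v).
have f_walk v : exists p, [/\ path e x0 p, last x0 p = v & size p = f v].
  by apply/walk_lengthP; rewrite /f; case: ex_minnP.
have f_min v p : path e x0 p -> last x0 p = v -> (f v <= size p)%N.
  move=> xp pv; rewrite /f; case: ex_minnP => k _; apply.
  by apply/walk_lengthP; exists p.
have f_edge u v : e u v -> (f v <= (f u).+1)%N.
  move=> uv; have [p [xp pu <-]] := f_walk u.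
  by rewrite -(size_rcons p v); apply: f_min; rewrite ?last_rcons // rcons_path xp pu.
exists f; split=> // [v|v k fv|v].
- apply/eqP/eqP => [fv|->]; last by apply/eqP; rewrite -leqn0 (f_min _ [::]).
  by have [p [_ pv sp]] := f_walk v; rewrite -pv (size0nil (etrans sp fv)).
- have [p] := f_walk v; rewrite fv; case/lastP: p => [[]//|p w [+ + /eqP]].
  rewrite rcons_path last_rcons size_rcons eqSS => /andP[xp pw] wv /eqP sp.
  exists (last x0 p); first by rewrite -wv.
  apply/eqP; rewrite eqn_leq -{1}sp f_min //= -ltnS -fv; apply: f_edge.
  by rewrite -wv.
by have [p [xp pv <-]] := f_walk v; apply: dist_le_walk.
Qed.
End DistanceLayers.

Lemma card_edges_dist_le (T : finType) (e : rel T) phi K :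
  symmetric e -> irreflexive e -> connected_graph e -> grid_minor e phi K ->
  forall x y, (#|edges e| + 3 * dist e x y + 4 <= 4 * #|T|)%N.
Proof.
move=> e_sym e_irr [_ conn] model x y.
have [f [f0 f_edge f_parent f_dist]] := distance_layers (conn x).
have f_max : exists2 v, f v = \max_v f v & forall u, (f u <= \max_v f v)%N.
  have T0 : (0 < #|T|)%N by apply/card_gt0P; exists x.
  have [v vmax] := bigop.eq_bigmax f T0; exists v => [|u]; first by rewrite vmax.
  exact: bigop.leq_bigmax.
have := card_edges_layers_le e_sym e_irr model f0 f_edge f_parent f_max.
apply: leq_trans; rewrite leq_add2r leq_add2l leq_mul2l /=.
by apply: leq_trans (f_dist y) _; apply: bigop.leq_bigmax.
Qed.
(** * From plane drawings to grid minors *)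

From mathcomp Require Import classical_sets topology normedtype.
Import numFieldNormedType.Exports.

Definition sup_near (R : realType) (eps : R) (p q : R * R) : Prop :=
  `|p.1 - q.1| < eps /\ `|p.2 - q.2| < eps.

Lemma sup_near_sym (R : realType) (eps : R) p q : sup_near eps p q -> sup_near eps q p.
Proof. by case=> h1 h2; split; rewrite distrC. Qed.

Lemma sup_near_triangle (R : realType) (d eps : R) p q r :
  sup_near d p q -> sup_near eps q r -> sup_near (d + eps) p r.
Proof.
by move=> [h1 h2] [k1 k2]; split; apply: le_lt_trans (ler_distD _ _ _) (ltrD _ _); eassumption.
Qed.

Lemma sup_near_le (R : realType) (d eps : R) p q : d <= eps -> sup_near d p q -> sup_near eps p q.
Proof. by move=> de [h1 h2]; split; apply: lt_le_trans de. Qed.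

Lemma not_sup_near_eq (R : realType) (p q : R * R) : p <> q -> exists2 eps, 0 < eps & ~ sup_near eps p q.
Proof.
case: p q => a b [c d] ne.
have [ac|ac] := eqVneq a c.
  have bd : b != d by apply/eqP => bd; apply: ne; rewrite ac bd.
  by exists `|b - d|; rewrite ?normr_gt0 ?subr_eq0 // => -[_] /=; rewrite ltxx.
by exists `|a - c|; rewrite ?normr_gt0 ?subr_eq0 // => -[] /=; rewrite ltxx.
Qed.

Definition curve (R : realType) (a b : R) (g : R -> R * R) : Prop :=
  forall t eps, a <= t <= b -> 0 < eps ->
    exists2 d, 0 < d & forall t', a <= t' <= b -> `|t' - t| < d -> sup_near eps (g t') (g t).

Lemma within_continuous_curve (R : realType) (g : R -> R * R) :
  {within `[0, 1], continuous g}%classic -> curve 0 1 g.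
Proof.
move=> /subspace_continuousP gc t eps tin e0.
have /cvg_ballP /(_ _ e0) := gc t tin; rewrite near_withinE => /nbhs_ballP [d /= d0 H].
exists d => // t' t'in tt; have [||h1 h2] := H t'; first by rewrite /ball /= distrC.
  by rewrite in_itv.
by apply: sup_near_sym.
Qed.

Lemma sub_curve (R : realType) (a b a' b' : R) g :
  a <= a' -> b' <= b -> curve a b g -> curve a' b' g.
Proof.
move=> aa bb gc t eps /andP[at_ tb] e0.
have [|d d0 H] := gc t eps _ e0; first by rewrite (le_trans aa) // (le_trans tb).
by exists d => // t' /andP[at' tb']; apply: H; rewrite (le_trans aa) // (le_trans tb').
Qed.

(* Cousin's lemma: an additive and locally valid property of intervals is valid. *)
Lemma segment_induction (R : realType) (a b : R) (P : R -> R -> Prop) :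
  (forall x y z, a <= x <= y -> y <= z <= b -> P x y -> P y z -> P x z) ->
  (forall t, a <= t <= b -> exists2 d, 0 < d &
     forall x y, a <= x -> x <= t <= y -> y <= b -> t - d < x -> y < t + d -> P x y) ->
  a <= b -> P a b.
Proof.
move=> add loc ab.
pose S : set R := [set y | a <= y <= b /\ P a y]%classic.
have Sa : S a.
  split; first by rewrite lexx.
  have [|d d0 H] := loc a; first by rewrite lexx.
  by apply: H; rewrite ?lexx // ?ltrDl // ltrBlDr ltrDl.
have supS : has_sup S by split; [exists a | exists b => y [/andP[]]].
set s := sup S.
have sb : s <= b by apply: ge_sup; [exists a | move=> y [/andP[]]].
have as_ : a <= s by apply: ub_le_sup => //; case: supS.
have [|d d0 H] := loc s; first by rewrite as_.
have [y Sy ys] := sup_adherent d0 supS; have [/andP[ay yb] Py] := Sy.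
have sy : y <= s by apply: ub_le_sup Sy; case: supS.
pose z := Num.min b (s + d / 2).
have d20 : 0 < d / 2 by rewrite divr_gt0.
have zb : z <= b by rewrite ge_min lexx.
have sz : s <= z by rewrite le_min sb lerDl ltW.
have zd : z < s + d by rewrite gt_min ltrD2l ltr_pdivrMr // mulr2n mulrDr mulr1 ltrDl d0 orbT.
have Pz : P a z.
  apply: (add a y z) => //; first by rewrite lexx.
    by rewrite (le_trans sy sz).
  by apply: H; rewrite ?sy.
have zs : z <= s.
  by apply: ub_le_sup; [case: supS | split=> //; rewrite (le_trans as_ sz)].
have : z = b.
  move: zs; rewrite /z; case: (leP b (s + d / 2)) => // _; rewrite gerDl; lra.
by move=> <-.
Qed.

Lemma curve_bounded (R : realType) (a b : R) g : a <= b -> curve a b g ->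
  exists2 M, 0 < M & forall t, a <= t <= b -> sup_near M (g t) 0.
Proof.
move=> ab gc.
pose P x y := exists2 M, 0 < M & forall t, x <= t <= y -> sup_near M (g t) 0.
apply: (@segment_induction R a b P) => // [x y z _ _ [M M0 HM] [N N0 HN]|t tab].
  exists (M + N); first exact: addr_gt0.
  move=> t /andP[xt tz]; case: (leP t y) => [ty|/ltW yt].
    by apply: sup_near_le (HM t _); rewrite ?xt // lerDl ltW.
  by apply: sup_near_le (HN t _); rewrite ?yt // lerDr ltW.
have [d d0 H] := gc t 1 tab ltr01; exists d => // x y ax /andP[xt ty] yb xd yd.
pose N := `|(g t).1| + `|(g t).2| + 1.
have N0 : 0 < N by rewrite /N ltr_wpDl // addr_ge0.
exists (1 + N); first exact: addr_gt0.
move=> t' /andP[xt' ty']; apply: sup_near_triangle (H t' _ _) _.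
- by rewrite (le_trans ax) // (le_trans ty').
- by rewrite ltr_distl; lra.
by rewrite /N; split; rewrite subr0; have := normr_ge0 (g t).1; have := normr_ge0 (g t).2; lra.
Qed.

Lemma curve_off_point (R : realType) (a b : R) g z : a <= b -> curve a b g ->
  (forall t, a <= t <= b -> g t <> z) ->
  exists2 eps, 0 < eps & forall t, a <= t <= b -> ~ sup_near eps (g t) z.
Proof.
move=> ab gc gz.
pose P x y := exists2 eps, 0 < eps & forall t, x <= t <= y -> ~ sup_near eps (g t) z.
apply: (@segment_induction R a b P) => // [x y w _ _ [M M0 HM] [N N0 HN]|t tab].
  have [mM mN] : Num.min M N <= M /\ Num.min M N <= N by rewrite !ge_min !lexx orbT.
  exists (Num.min M N); first by rewrite lt_min M0.
  move=> t /andP[xt tz]; case: (leP t y) => [ty|/ltW yt].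
    by move/(sup_near_le mM); apply: HM; rewrite xt.
  by move/(sup_near_le mN); apply: HN; rewrite yt.
have [eps e0 ne] := not_sup_near_eq (gz t tab).
have e20 : 0 < eps / 2 by rewrite divr_gt0.
have [d d0 H] := gc t _ tab e20; exists d => // x y ax /andP[xt ty] yb xd yd.
exists (eps / 2) => // t' /andP[xt' ty'] nt; apply: ne.
rewrite [eps]splitr; apply: sup_near_triangle nt; apply/sup_near_sym/H.
  by rewrite (le_trans ax) // (le_trans ty').
by rewrite ltr_distl; lra.
Qed.

(** Compactness twice: for fixed t the second curve keeps a distance from [g t] by
    [curve_off_point], half of it persists for times near t, and [segment_induction] over t makes it
    uniform. *)
Lemma curves_apart (R : realType) (a b a' b' : R) g g' :
  a <= b -> a' <= b' -> curve a b g -> curve a' b' g' ->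
  (forall t t', a <= t <= b -> a' <= t' <= b' -> g t <> g' t') ->
  exists2 eps, 0 < eps & forall t t', a <= t <= b -> a' <= t' <= b' -> ~ sup_near eps (g t) (g' t').
Proof.
move=> ab ab' gc gc' gg.
pose P x y := exists2 eps, 0 < eps & forall t t', x <= t <= y -> a' <= t' <= b' -> ~ sup_near eps (g t) (g' t').
apply: (@segment_induction R a b P) => // [x y w _ _ [M M0 HM] [N N0 HN]|t tab].
  have [mM mN] : Num.min M N <= M /\ Num.min M N <= N by rewrite !ge_min !lexx orbT.
  exists (Num.min M N); first by rewrite lt_min M0.
  move=> t t' /andP[xt tz] t'ab; case: (leP t y) => [ty|/ltW yt].
    by move/(sup_near_le mM); apply: HM; rewrite ?xt.
  by move/(sup_near_le mN); apply: HN; rewrite ?yt.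
have [eps e0 ne] := curve_off_point ab' gc' (fun t' t'ab E => gg t t' tab t'ab (esym E)).
have e20 : 0 < eps / 2 by rewrite divr_gt0.
have [d d0 H] := gc t _ tab e20; exists d => // x y ax /andP[xt ty] yb xd yd.
exists (eps / 2) => // u t' /andP[xu uy] t'ab nt; apply: (ne t' t'ab).
rewrite [eps]splitr; apply: sup_near_triangle (sup_near_sym nt) _; apply: H.
  by rewrite (le_trans ax) // (le_trans uy).
by rewrite ltr_distl; lra.
Qed.

Lemma finite_eps (R : realType) (I : finType) (P : I -> R -> Prop) :
  (forall i, exists2 eps, 0 < eps & P i eps) ->
  (forall i eps eps', 0 < eps' -> eps' <= eps -> P i eps -> P i eps') ->
  exists2 eps, 0 < eps & forall i, P i eps.
Proof.
move=> ex down.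
suff [eps e0 H] : exists2 eps, 0 < eps & {in enum I, forall i, P i eps}.
  by exists eps => // i; apply: H; rewrite mem_enum.
elim: (enum I) => [|i s [eps e0 H]]; first by exists 1.
have [d d0 Hi] := ex i.
have m0 : 0 < Num.min d eps by rewrite lt_min d0.
exists (Num.min d eps) => // j; rewrite inE => /predU1P[->|/H].
  by apply: down Hi; rewrite // ge_min lexx.
by apply: down; rewrite // ge_min lexx orbT.
Qed.

(** * Rounding points of the plane to cells *)

Section Discretisation.
Variables (R : realType) (n : nat) (M : R).
Hypothesis n_gt0 : (0 < n)%N.

(** The shift by [M] makes the truncated number nonnegative for |x| < M, so that truncation rounds
    down. *)
Definition discrete (x : R) : nat := Num.truncn (n%:R * (x + M)).
Definition discrete2 (p : R * R) : cell := (discrete p.1, discrete p.2).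

Let n0 : 0 < n%:R :> R. Proof. by rewrite ltr0n. Qed.

Let bounds x : `|x| < M -> (discrete x)%:R <= n%:R * (x + M) < (discrete x)%:R + 1.
Proof.
rewrite ltr_norml => /andP[h _]; rewrite natr1; apply: truncn_itv.
by rewrite mulr_ge0 ?ltW //; lra.
Qed.

Let discrete_le x y eps k : `|x| < M -> `|y| < M -> n%:R * eps <= k%:R -> x - y < eps ->
  (discrete x <= discrete y + k)%N.
Proof.
move=> /bounds/andP[h1 h2] /bounds/andP[h3 h4] nk xy.
rewrite -ltnS -(ltr_nat R) -natr1 natrD.
have : n%:R * (x - y) < n%:R * eps by rewrite ltr_pM2l.
rewrite mulrBr; move: h1 h2 h3 h4; rewrite !mulrDr; lra.
Qed.

Let discrete_lt x y k : `|x| < M -> `|y| < M ->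
  (discrete x <= discrete y + k)%N -> x - y < k.+1%:R / n%:R.
Proof.
move=> /bounds/andP[h1 h2] /bounds/andP[h3 h4].
rewrite -(ler_nat R) natrD ltr_pdivlMr // -natr1 mulrC mulrBr.
move: h1 h2 h3 h4; rewrite !mulrDr; lra.
Qed.

Lemma sup_near_in_box eps k p q : sup_near M p 0 -> sup_near M q 0 -> n%:R * eps <= k%:R ->
  sup_near eps p q -> in_box k (discrete2 p) (discrete2 q).
Proof.
rewrite /sup_near !subr0 !ltr_norml => [[p1 p2]] [q1 q2] nk [/andP[h1 h2] /andP[h3 h4]].
by apply/and4P; split; apply: (discrete_le (eps := eps)) => //; rewrite ?ltr_norml //; lra.
Qed.

Lemma in_box_sup_near k p q : sup_near M p 0 -> sup_near M q 0 ->
  in_box k (discrete2 p) (discrete2 q) -> sup_near (k.+1%:R / n%:R) p q.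
Proof.
rewrite /sup_near !subr0 => [[p1 p2]] [q1 q2] /and4P[h1 h2 h3 h4].
rewrite !ltr_norml -![_ < _ - _]ltrN2 !opprK !opprB.
by rewrite !discrete_lt.
Qed.

(** Around each time the curve moves by less than 1/n, so its cells stay in a box of radius 1; boxes
    are connected, and [segment_induction] chains them. *)
Lemma curve_linked a b g : a <= b -> curve a b g ->
  (forall t, a <= t <= b -> sup_near M (g t) 0) ->
  linked (fun c => exists2 t, a <= t <= b & in_box 1 (discrete2 (g t)) c)
    (discrete2 (g a)) (discrete2 (g b)).
Proof.
move=> ab gc gM; set Q := fun c => _.
apply: (@segment_induction R a b (fun x y => linked Q (discrete2 (g x)) (discrete2 (g y)))) => //.
  by move=> x y z _ _; apply: linked_trans.
move=> t tab; have ninv : 0 < n%:R^-1 :> R by rewrite invr_gt0.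
have [d d0 H] := gc t _ tab ninv; exists d => // x y ax /andP[xt ty] yb xd yd.
have box1 u : a <= u <= b -> `|u - t| < d -> in_box 1 (discrete2 (g t)) (discrete2 (g u)).
  move=> uab ut; apply: sup_near_in_box (sup_near_sym (H u uab ut)); rewrite ?mulfV ?gt_eqF //; exact: gM.
have box_t u v : a <= u <= b -> a <= v <= b -> `|u - t| < d -> `|v - t| < d -> linked Q (discrete2 (g u)) (discrete2 (g v)).
  move=> uab vab ut vt; apply: sub_linked (in_box_linked (box1 u uab ut) (box1 v vab vt)).
  by move=> c cb; exists t.
apply: box_t; rewrite ?ax ?yb ?(le_trans xt) ?(le_trans ax) ?(le_trans xt) ?ltr_distl //=; lra.
Qed.
End Discretisation.

Lemma in_box_common j k c c' p : in_box j c p -> in_box k c' p -> in_box (j + k) c c'.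
Proof. by rewrite /in_box; lia. Qed.

Lemma in_box_range k K c p : in_box k c p -> (k < c.1)%N -> (k < c.2)%N ->
  (c.1 + k < K)%N -> (c.2 + k < K)%N -> (0 < p.1 < K)%N && (0 < p.2 < K)%N.
Proof. by rewrite /in_box; lia. Qed.

(** * A grid minor from well separated curves *)

Section CurveSystem.
Variables (R : realType) (T : finType) (e : rel T) (O : {set T * T}).
Variables (pos : T -> R * R) (g : T * T -> R -> R * R) (r s eta M0 : R).
Hypothesis e_sym : symmetric e.
Hypothesis eO : forall x y, e x y -> ((x, y) \in O) || ((y, x) \in O).
Hypothesis O_irr : forall l, l \in O -> l.1 != l.2.
Hypothesis r_gt0 : 0 < r.
Hypothesis r_le1 : 3 * r <= 1.
Hypothesis pos_apart : forall x y, x != y -> ~ sup_near (3 * r) (pos x) (pos y).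
Hypothesis g_pos_apart : forall l z t, l \in O -> z != l.1 -> z != l.2 -> 0 <= t <= 1 ->
  ~ sup_near (3 * r) (g l t) (pos z).
Hypothesis s_gt0 : 0 < s.
Hypothesis s_le1 : 3 * s <= 1.
Hypothesis g_curve : forall l, l \in O -> curve s (1 - s) (g l).
Hypothesis g_start : forall l, l \in O -> sup_near (r / 2) (g l s) (pos l.1).
Hypothesis g_end : forall l, l \in O -> sup_near (r / 2) (g l (1 - s)) (pos l.2).
Hypothesis eta_gt0 : 0 < eta.
Hypothesis g_apart : forall l l' t t', l \in O -> l' \in O -> l != l' ->
  s <= t <= 1 - s -> s <= t' <= 1 - s -> ~ sup_near eta (g l t) (g l' t').
Hypothesis M0_gt0 : 0 < M0.
Hypothesis gM0 : forall l t, l \in O -> 0 <= t <= 1 -> sup_near M0 (g l t) 0.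
Hypothesis posM0 : forall x, sup_near M0 (pos x) 0.

Let mid' (t : R) : s <= t <= 1 - s -> 0 <= t <= 1.
Proof. move: s_gt0; lra. Qed.
Let s_mid : s <= 1 - s. Proof. move: s_gt0 s_le1; lra. Qed.

(* The cells are squares of side 1 / n. A vertex takes the box of half-width about r
   around it, an edge the cells next to its arc between the times s and 1 - s. *)
Lemma curve_system_grid_minor : exists K phi, grid_minor e phi K.
Proof.
(* The margin 1 is n cells wide, more than the radius of any box used, so boxes keep clear of the
   coordinate axes. *)
pose M := M0 + 1.
have M0M : M0 <= M by rewrite lerDl.
have gM l t : l \in O -> s <= t <= 1 - s -> sup_near M (g l t) 0.
  by move=> lO /mid' tin; apply: sup_near_le M0M (gM0 _ _).
have posM x : sup_near M (pos x) 0 by apply: sup_near_le M0M (posM0 x).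
(* With r n >= 2 the rounded radius [rho] is at least r n / 2 and still covers the ends of the
   trimmed arcs. With eta n >= 3 two strips cannot share a cell, which would bring the arcs within
   3/n. *)
pose n := ((Num.truncn (2 / r)).+1 + (Num.truncn (3 / eta)).+1)%N.
have n_gt1 : (1 < n)%N by rewrite /n addSn addnS.
have n_gt0 : (0 < n)%N by apply: ltnW.
have nR_gt0 : 0 < n%:R :> R by rewrite ltr0n.
have rn : 2 <= r * n%:R.
  rewrite mulrC -ler_pdivrMr // natrD ltW // (lt_le_trans (truncnS_gt _)) // lerDl ler0n //.
have etan : 3 <= eta * n%:R.
  rewrite mulrC -ler_pdivrMr // natrD ltW // (lt_le_trans (truncnS_gt _)) // lerDr ler0n //.
pose rho := Num.truncn (r * n%:R).
have /andP[rho_le rho_gt] : rho%:R <= r * n%:R < rho%:R + 1.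
  by rewrite natr1; apply: truncn_itv; lra.
have rn1 : r * n%:R * 3 <= n%:R.
  have -> : r * n%:R * 3 = (3 * r) * n%:R by ring.
  by rewrite ler_piMl // ltW.
have rho_lt : (rho < n)%N by rewrite -(ltr_nat R); lra.
pose D := discrete2 n M.
pose K := (Num.truncn (n%:R * (M + M)) + n + 2)%N.
have D_supp p : sup_near M0 p 0 -> [/\ n <= (D p).1, n <= (D p).2, (D p).1 + n + 1 < K & (D p).2 + n + 1 < K]%N.
  case; rewrite !subr0 !ltr_norml => /andP[h1 h2] /andP[h3 h4].
  have lo (u : R) : - M0 < u -> (n <= discrete n M u)%N.
    move=> hu; rewrite truncn_ge_nat; first by rewrite ler_peMr ?ltW //; rewrite /M; lra.
    by rewrite mulr_ge0 ?ltW //; rewrite /M; lra.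
  have hi (u : R) : u < M0 -> (discrete n M u + n + 1 < K)%N.
    move=> hu; have : (discrete n M u <= Num.truncn (n%:R * (M + M)))%N.
      by apply: le_truncn; rewrite ler_pM2l // lerD2r /M; lra.
    by rewrite /K; move: (Num.truncn _) => k; clear; lia.
  by rewrite !lo ?hi.
exists K; apply: (@assemble T O (fun x => in_box rho (D (pos x)))
    (fun l c => exists2 t, s <= t <= 1 - s & in_box 1 (D (g l t)) c)) => //.
  - by move=> x p q; apply: in_box_linked.
  - move=> x y p bx by_; apply/eqP/negPn/negP => xy; apply: (pos_apart xy).
    have B := in_box_common bx by_.
    apply: sup_near_le (in_box_sup_near n_gt0 (posM x) (posM y) B).
    rewrite ler_pdivrMr // -natr1 natrD; lra.
  - move=> l z p lO [t tin bt] bz.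
    have [|z1] := eqVneq z l.1; first by left.
    have [|z2] := eqVneq z l.2; first by right.
    case: (g_pos_apart lO z1 z2 (mid' tin)).
    have B := in_box_common bt bz.
    apply: sup_near_le (in_box_sup_near n_gt0 (gM l t lO tin) (posM z) B).
    rewrite ler_pdivrMr // -natr1 natrD; lra.
  - move=> l l' p lO lO' [t tin bt] [t' t'in bt']; apply/eqP/negPn/negP => ll'.
    apply: (g_apart lO lO' ll' tin t'in).
    have B := in_box_common bt bt'.
    apply: sup_near_le (in_box_sup_near n_gt0 (gM l t lO tin) (gM l' t' lO' t'in) B).
    by rewrite ler_pdivrMr.
  - move=> l lO; exists (D (g l s)), (D (g l (1 - s))).
    have [h1 h2] := (g_start lO, g_end lO).
    have rrho : n%:R * (r / 2) <= rho%:R by lra.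
    split; last by apply: curve_linked => //; [exact: g_curve | move=> t tin; exact: gM].
      by apply: sup_near_in_box (sup_near_sym h1) => //; apply: gM; rewrite // lexx s_mid.
    by apply: sup_near_in_box (sup_near_sym h2) => //; apply: gM; rewrite // s_mid lexx.
  - move=> x p /in_box_range; apply; have [h1 h2 h3 h4] := D_supp _ (posM0 x); first exact: leq_trans h1.
    + exact: leq_trans h2.
    + by apply: leq_ltn_trans h3; rewrite -addnA leq_add2l (leq_trans (ltnW rho_lt)) // leq_addr.
    by apply: leq_ltn_trans h4; rewrite -addnA leq_add2l (leq_trans (ltnW rho_lt)) // leq_addr.
  - move=> l p lO [t tin] /in_box_range; apply; have [h1 h2 h3 h4] := D_supp _ (gM0 lO (mid' tin)).
    + exact: leq_trans h1.
    + exact: leq_trans h2.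
    + by apply: leq_ltn_trans h3; rewrite leq_add2r leq_addr.
    by apply: leq_ltn_trans h4; rewrite leq_add2r leq_addr.
Qed.
End CurveSystem.

(** Arcs with a common end get arbitrarily close there, so each is trimmed to the times from s to 1
    - s, with its new ends within r/2 of the vertices. The trimmed arcs are disjoint and compact,
    hence some eta apart. The choices come in the order r, s, eta. *)
Lemma planar_grid_minor (R : realType) (T : finType) (e : rel T) :
  symmetric e -> irreflexive e -> planar R e -> exists phi K, grid_minor e phi K.
Proof.
move=> e_sym e_irr [pos [arc [pos_inj arcP arc_pos arc_meet]]].
pose O := [set l : T * T | e l.1 l.2 && (enum_rank l.1 < enum_rank l.2)%N].
have Oe l : l \in O -> e l.1 l.2 by rewrite inE => /andP[].
have O_irr l : l \in O -> l.1 != l.2.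
  by move/Oe; apply: contraTneq => ->; rewrite e_irr.
have eO x y : e x y -> ((x, y) \in O) || ((y, x) \in O).
  move=> xy; rewrite !inE /= (e_sym y) xy /= -neq_ltn (inj_eq (@ord_inj _)).
  by rewrite (inj_eq enum_rank_inj); apply: contraTneq xy => ->; rewrite e_irr.
have ends_inj l l' : l \in O -> l' \in O -> [set l.1; l.2] = [set l'.1; l'.2] -> l = l'.
  case: l l' => x y [x' y'] /= lO lO' E.
  have := O_irr _ lO; have : x \in [set x'; y'] by rewrite -E !inE eqxx.
  have : y \in [set x'; y'] by rewrite -E !inE eqxx orbT.
  rewrite !inE => /orP[]/eqP yE /orP[]/eqP xE; rewrite ?{}xE ?{}yE ?eqxx // in lO lO' * => _.
  by move: lO lO'; rewrite !inE /= => /andP[_ h] /andP[_]; rewrite ltnNge ltnW.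
have edge_in l : l \in O -> [set l.1; l.2] \in edges e.
  by move/Oe => el; rewrite inE; apply/existsP; exists l.1; apply/existsP; exists l.2; rewrite el eqxx.
have /choice[g gP] : forall l, exists g : R -> R * R, l \in O ->
    [/\ curve 0 1 g, {in `[0, 1] &, injective g}, g 0 = pos l.1, g 1 = pos l.2 &
        forall t, 0 <= t <= 1 -> arc [set l.1; l.2] (g t)].
  move=> l; case: (boolP (l \in O)) => [lO|_]; last by exists (fun=> 0).
  have [g [gc gi g0 g1 ga]] := arcP _ _ (Oe l lO).
  exists g => _; split=> // [|t t01]; first exact: within_continuous_curve.
  by rewrite ga; exists t => //=; rewrite in_itv.
have in01 (t : R) : 0 <= t <= 1 -> t \in `[0, 1] by rewrite in_itv.
have g_off l z t : l \in O -> z != l.1 -> z != l.2 -> 0 <= t <= 1 -> g l t <> pos z.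
  move=> lO z1 z2 t01 E; have [_ _ _ _ ga] := gP l lO.
  have := arc_pos _ z (edge_in l lO); rewrite -E => /(_ (ga t t01)).
  by rewrite !inE (negPf z1) (negPf z2).
(* A common point is the position of an end of the first arc, and injectivity confines it to the
   times 0 and 1. *)
have g_disj l l' t t' : l \in O -> l' \in O -> l != l' -> 0 < t < 1 -> 0 <= t' <= 1 -> g l t <> g l' t'.
  move=> lO lO' ll' /andP[t0 t1] t'01 E; have [_ gi g0 g1 ga] := gP l lO; have [_ _ _ _ ga'] := gP l' lO'.
  have t01 : 0 <= t <= 1 by rewrite !ltW.
  have : (arc [set l.1; l.2]%SET `&` arc [set l'.1; l'.2]%SET)%classic (g l t).
    by split; [apply: ga | rewrite E; apply: ga'].
  have ne : [set l.1; l.2] != [set l'.1; l'.2] by apply: contra ll' => /eqP/ends_inj->.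
  move/(arc_meet _ _ (edge_in l lO) (edge_in l' lO') ne) => [z /=].
  rewrite !inE => /andP[/orP[]/eqP-> _].
    rewrite -g0 => /(gi 0 t) E0; move: t0; rewrite -E0 ?ltxx //; apply: in01 => //.
    by rewrite lexx ler01.
  rewrite -g1 => /(gi 1 t) E0; move: t1; rewrite -E0 ?ltxx //; apply: in01 => //.
  by rewrite lexx ler01.
have [r1 r1_gt0 r1P] : exists2 r, 0 < r & forall xy : T * T, xy.1 != xy.2 -> ~ sup_near r (pos xy.1) (pos xy.2).
  apply: finite_eps => [[x y]|xy eps eps' _ ee H ne] /=; last by move/(sup_near_le ee); apply: H.
  have [->|xy] := eqVneq x y; first by exists 1.
  have [|r r0 H] := @not_sup_near_eq _ (pos x) (pos y); last by exists r.
  by move/pos_inj => E; rewrite E eqxx in xy.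
have [r2 r2_gt0 r2P] : exists2 r, 0 < r & forall lz : (T * T) * T, lz.1 \in O -> lz.2 != lz.1.1 -> lz.2 != lz.1.2 ->
    forall t, 0 <= t <= 1 -> ~ sup_near r (g lz.1 t) (pos lz.2).
  apply: finite_eps => [[l z]|lz eps eps' _ ee H h1 h2 h3 t t01] /=; last by move/(sup_near_le ee); apply: H.
  case: (boolP (l \in O)) => [lO|_]; last by exists 1.
  have [gc _ _ _ _] := gP l lO.
  have [->|z1] := eqVneq z l.1; first by exists 1.
  have [->|z2] := eqVneq z l.2; first by exists 1.
  have [t t01|r r0 H] := curve_off_point ler01 gc (z := pos z); first exact: g_off.
  by exists r.
(* The third is due to boxes of radius [rho] with a common cell: their centres are within (2 rho +
   1)/n <= 3r. *)
pose r := Num.min 1 (Num.min r1 r2) / 3.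
have r_gt0 : 0 < r by rewrite /r divr_gt0 // !lt_min ltr01 r1_gt0 r2_gt0.
have [rle1 rler1 rler2] : [/\ 3 * r <= 1, 3 * r <= r1 & 3 * r <= r2].
  have -> : 3 * r = Num.min 1 (Num.min r1 r2) by rewrite /r mulrC divfK ?pnatr_eq0.
  by split; rewrite !ge_min lexx ?orbT.
have r2_0 : 0 < r / 2 by rewrite divr_gt0.
have [s0 s0_gt0 s0P] : exists2 s0, 0 < s0 & forall l, l \in O -> forall s, 0 <= s -> s < s0 -> s <= 1 ->
    sup_near (r / 2) (g l s) (pos l.1) /\ sup_near (r / 2) (g l (1 - s)) (pos l.2).
  apply: finite_eps => [l|l eps eps' _ ee H lO s s_ge0 se]; last by apply: H => //; apply: lt_le_trans ee.
  case: (boolP (l \in O)) => [lO|_]; last by exists 1.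
  have [gc _ g0 g1 _] := gP l lO.
  have [|d d0 Hd] := gc 0 _ _ r2_0; first by rewrite lexx ler01.
  have [|d' d'0 Hd'] := gc 1 _ _ r2_0; first by rewrite lexx ler01.
  exists (Num.min d d') => [|_ s s_ge0]; first by rewrite lt_min d0.
  rewrite lt_min => /andP[sd sd'] s1; rewrite -g0 -g1; split.
    by apply: Hd; rewrite ?s_ge0 // subr0 ger0_norm.
  by apply: Hd'; [lra | rewrite addrC addKr normrN ger0_norm].
pose s := Num.min s0 1 / 3.
have s_gt0 : 0 < s by rewrite /s divr_gt0 // lt_min s0_gt0 ltr01.
have [sls0 sle1] : 3 * s <= s0 /\ 3 * s <= 1.
  have -> : 3 * s = Num.min s0 1 by rewrite /s mulrC divfK ?pnatr_eq0.
  by split; rewrite !ge_min lexx ?orbT.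
have mid (t : R) : s <= t <= 1 - s -> 0 < t < 1 by lra.
have mid' (t : R) : s <= t <= 1 - s -> 0 <= t <= 1 by lra.
have s_mid : s <= 1 - s by lra.
have gcm l : l \in O -> curve s (1 - s) (g l).
  by case/gP => gc _ _ _ _; apply: sub_curve gc; lra.
have [eta eta_gt0 etaP] : exists2 eta, 0 < eta & forall ll : (T * T) * (T * T), ll.1 \in O -> ll.2 \in O -> ll.1 != ll.2 ->
    forall t t', s <= t <= 1 - s -> s <= t' <= 1 - s -> ~ sup_near eta (g ll.1 t) (g ll.2 t').
  apply: finite_eps => [[l l']|ll eps eps' _ ee H h1 h2 h3 t t' tin t'in] /=; last by move/(sup_near_le ee); apply: H.
  case: (boolP (l \in O)) => [lO|_]; last by exists 1.
  case: (boolP (l' \in O)) => [lO'|_]; last by exists 1.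
  have [->|ll'] := eqVneq l l'; first by exists 1.
  have [t t' /mid tin /mid' t'in|eps e0 H] := curves_apart s_mid s_mid (gcm l lO) (gcm l' lO'); first exact: g_disj.
  by exists eps.
(* The bound is sought as an inverse, since [finite_eps] treats conditions that persist when the
   number shrinks. *)
have [m m_gt0 mP] : exists2 m, 0 < m & (forall l, l \in O -> forall t, 0 <= t <= 1 -> sup_near m^-1 (g l t) 0) /\ 
    forall x, sup_near m^-1 (pos x) 0.
  have [m m0 H] : exists2 m, 0 < m & forall x : (T * T) + T, match x with
     | inl l => l \in O -> forall t, 0 <= t <= 1 -> sup_near m^-1 (g l t) 0
     | inr x => sup_near m^-1 (pos x) 0 end.
    apply: finite_eps => [[l|x]|x d d' d'0 dd].
    - case: (boolP (l \in O)) => [lO|_]; last by exists 1.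
      have [gc _ _ _ _] := gP l lO; have [M M0 H] := curve_bounded ler01 gc.
      by exists M^-1; rewrite ?invr_gt0 ?invrK.
    - exists (`|(pos x).1| + `|(pos x).2| + 1)^-1.
        by rewrite invr_gt0 ltr_wpDl // addr_ge0.
      by rewrite invrK; split; rewrite subr0; have := normr_ge0 (pos x).1; have := normr_ge0 (pos x).2; lra.
    have dd' : d^-1 <= d'^-1 by rewrite lef_pV2 ?posrE // (lt_le_trans d'0).
    case: x => [l H lO t tin|x H]; apply: sup_near_le dd' _; last exact: H.
    exact: H.
  by exists m => //; split=> [l|x]; [apply: (H (inl l)) | apply: (H (inr x))].
have [K [phi phiP]] : exists K phi, grid_minor e phi K; last by exists phi, K.
apply: (@curve_system_grid_minor R T e O pos g r s eta m^-1) => //.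
- by move=> x y xy /(sup_near_le rler1); apply: (r1P (x, y)).
- by move=> l z t lO z1 z2 t01 /(sup_near_le rler2); apply: (r2P (l, z)).
- by move=> l lO; apply: (s0P l lO s _ _ _).1; move: s_gt0 sls0 sle1; clear; lra.
- by move=> l lO; apply: (s0P l lO s _ _ _).2; move: s_gt0 sls0 sle1; clear; lra.
- by move=> l l' t t' lO lO' ll'; apply: (etaP (l, l')).
- by move=> l t lO; apply: mP.1.
- exact: mP.2.
Qed.

Theorem theorem2 (R : realType) (T : finType) (e : rel T)
  (e_sym : symmetric e) (e_irr : irreflexive e)
  (e_conn : connected_graph e) (e_planar : planar R e) :
  ((diameter e)%:R : rat) <= (4 * (#|T|%:R - 1) - #|edges e|%:R) / 3.
Proof.
have [phi [K model]] := planar_grid_minor e_sym e_irr e_planar.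
have dist_bound := card_edges_dist_le e_sym e_irr e_conn model.
have diam : (#|edges e| + 3 * diameter e + 4 <= 4 * #|T|)%N.
  have [T0 _] := e_conn.
  have [x dx] := bigop.eq_bigmax (fun x => \max_(y : T) dist e x y) T0.
  have [y dy] := bigop.eq_bigmax (fun y => dist e x y) T0.
  by rewrite /diameter dx dy.
rewrite ler_pdivlMr // mulrBr mulr1 lerBrDr lerBrDr.
by rewrite -!natrM -!natrD ler_nat; lia.
Qed.
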